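(* As $n\to\infty$, we have $$p(3,n)=\exp\left(\pi\sqrt{\frac{11n}{3}}+O(\log n)\right).$$
   Context: For positive integers $m,n$, let $R=[0,m]\times[0,n]\subset\mathbb{R}^2$. All rectangles have sides parallel to the coordinate axes. A partition of the rectangle $R$ is a multiset of rectangles $\{R_i\}_{i\in I}$ such that: (1) each $R_i$ has positive integer side lengths; (2) rectangles of sizes $k\times l$ and $l\times k$ are regarded as indistinguishable; (3) all the rectangles of the multiset can be arranged so that they cover exactly $R$ and their interiors are pairwise disjoint. Two partitions are the same if they are equal as multisets (of rectangle types, up to rotation); the geometric arrangement is irrelevant. $p(m,n)$ denotes the number of partitions of the $m\times n$ rectangle. *)

(* Defs.v *)
From HB Require Import structures.
From mathcomp Require Import all_boot all_order all_algebra.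
From mathcomp Require Import finmap multiset.
From mathcomp Require Import all_classical all_reals all_analysis.

Set Implicit Arguments.
Unset Strict Implicit.
Unset Printing Implicit Defensive.

Import Order.TTheory GRing.Theory Num.Theory.
Import numFieldNormedType.Exports.

Local Open Scope fset_scope.
Local Open Scope mset_scope.
Local Open Scope classical_set_scope.
Local Open Scope ring_scope.

(* An axis-parallel rectangle in the plane: its lower left corner is an
   arbitrary point of R * R, only its side lengths are natural numbers. *)
Record rectangle (R : realType) := Rectangle {
  corner : R * R;
  width : nat;
  height : nat
}.

Definition rect_set (R : realType) (r : rectangle R) : set (R * R) :=
  `[(corner r).1, (corner r).1 + (width r)%:R] `*`
  `[(corner r).2, (corner r).2 + (height r)%:R].

(* The sizes k x l and l x k are identified by listing the shorter side
   first. *)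
Definition rect_type (R : realType) (r : rectangle R) : nat * nat :=
  (minn (width r) (height r), maxn (width r) (height r)).

Definition is_tiling (R : realType) (m n k : nat)
    (T : 'I_k -> rectangle R) : Prop :=
  [/\ forall i, (0 < width (T i))%N /\ (0 < height (T i))%N,
      \bigcup_i rect_set (T i) = `[0, m%:R] `*` `[0, n%:R]
    & trivIset [set: 'I_k] (fun i => (rect_set (T i))°)].

Definition rect_partitions (R : realType) (m n : nat) :
    set {mset (nat * nat)%type} :=
  [set M | exists (k : nat) (T : 'I_k -> rectangle R),
     is_tiling m n T /\ M = seq_mset [seq rect_type (T i) | i : 'I_k]].

(* [fset_set] returns the empty set on infinite sets. This default is not
   reached here: by area, the k rectangles of a tiling satisfy k <= m * n, and
   their side lengths are at most maxn m n. *)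
Definition num_partitions (R : realType) (m n : nat) : nat :=
  #|` fset_set (rect_partitions R m n) |.

(* Main.v *)
Require Import Defs.
From HB Require Import structures.
From mathcomp Require Import all_boot all_order all_algebra.
From mathcomp Require Import finmap multiset.
From mathcomp Require Import all_classical all_reals all_analysis.
From mathcomp Require Import ring lra zify.

Set Implicit Arguments.
Unset Strict Implicit.
Unset Printing Implicit Defensive.

Import Order.TTheory GRing.Theory Num.Theory.
Import numFieldNormedType.Exports.

Local Open Scope classical_set_scope.
Local Open Scope ring_scope.

(** Why the theorem holds.

A tile of a 3 x n rectangle has a side of length at most 3, so a partition of
the rectangle is determined by three integer partitions, listing the lengths of
the tiles of width 1, 2 and 3. If they are partitions of a, b and c, then
comparing areas gives a + 2 b + 3 c = 3 n. The number p(m) of integer partitions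
of m satisfies p(m) = exp (gamma sqrt m + O(log m)) with gamma = pi sqrt (2/3)
([card_partitions_le] and [card_partitions_ge]). Up to a polynomial factor, the
number of triples is therefore the maximum of
exp (gamma (sqrt a + sqrt b + sqrt c)), and by the Cauchy-Schwarz inequality the
maximum of sqrt a + sqrt b + sqrt c is sqrt (11/6 * 3 n), attained for a, b, c
proportional to 36, 9, 4. As gamma sqrt (11 n / 2) = pi sqrt (11 n / 3), this is
the upper bound ([num_partitions_le]).

For the lower bound, fix a, b, c in these proportions. The tiles of width 3 are
stacked at the bottom, those of width 2 above them in the first two columns, and
what remains are three columns to be filled by strips of width 1
([tileable_with_units]). The strips of width 1 have to be distributed to three
groups with prescribed total lengths. A greedy choice achieves this if no strip
is longer than K and if there are 3 K extra unit squares to fill the remaining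
gaps ([split_in_three]). For K of order sqrt n * log n, the area of the unit
squares changes the exponent only by O(log n), and partitions with a part larger
than K are a minority ([card_partitions_upto_ge]). Finally, the identification of
2 x 1 with 1 x 2, of 3 x 1 with 1 x 3 and of 3 x 2 with 2 x 3 merges at most
(3 n + 1)^3 triples ([card_product_le_num_partitions]).

The estimate of p(m) is obtained as in Erdos' elementary proof, by induction
from the identity m p(m) = sum of v p(m - k v) over k, v >= 1
([partitions_recursion]). Near m, exp (gamma sqrt (m - j)) is about
exp (gamma sqrt m - t j) with t = gamma / (2 sqrt m). The sum of v exp (- k v t)
over v is about 1 / (k t)^2, and the sum of 1 / k^2 is pi^2 / 6, so that the
right-hand side is about pi^2 / (6 t^2) = m times exp (gamma sqrt m). For the
upper bound all these approximations are inequalities in the right direction.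
For the lower bound their errors have relative size 1 / sqrt m; they are
compensated by a factor m^(-C), whose variation between m and m - j brings a
gain of the same order, multiplied by C ([saddle_total_ge]). Finally,
Euler's sum of 1 / k^2 is obtained with a rate of convergence from a halving
identity for 1 / sin^2 ([sum_sqrV_le], [sum_sqrV_ge]). *)

(** * The sum of the inverse squares *)

Lemma ler_of_derive_ge0 (R : realType) (f df : R -> R) (b : R) :
  0 <= b -> (forall x : R, is_derive x 1 f (df x)) ->
  (forall x, 0 <= x <= b -> 0 <= df x) -> f 0 <= f b.
Proof.
move=> b0 fdf df0.
have [|z zab fE] := @MVT_segment R f df 0 b b0 (fun x _ => fdf x).
  apply: continuous_subspaceT => x.
  by apply/differentiable_continuous/derivable1_diffP; have [] := fdf x.
rewrite -subr_ge0 fE subr0 mulr_ge0// df0//.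
Qed.

Lemma sin_le (R : realType) (x : R) : 0 <= x -> sin x <= x.
Proof.
move=> x0.
have := @ler_of_derive_ge0 R (fun y => y - sin y) (fun y => 1 - cos y) x x0.
rewrite sin0 subr0 subr_ge0; apply.
by move=> y _; rewrite subr_ge0 cos_le1.
Qed.

Lemma mulr_cos_le_sin (R : realType) (x : R) :
  0 <= x <= pi -> x * cos x <= sin x.
Proof.
move=> /andP[x0 xpi].
have := @ler_of_derive_ge0 R (fun y => sin y - y * cos y)
  (fun y => y * sin y) x x0.
rewrite sin0 mul0r subr0 subr_ge0; apply.
  move=> y /=; apply: (@is_derive_eq R R R (sin - id * cos)).
  by rewrite /GRing.scale /=; ring.
move=> y /andP[y0 yx]; rewrite mulr_ge0// sin_ge0_pi// y0/=.
exact: le_trans xpi.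
Qed.

(** This is [sin x <= x <= tan x], squared and inverted. *)
Lemma sin_sqrV_bounds (R : realType) (x : R) : 0 < x < pi / 2 ->
  (x ^+ 2)^-1 <= (sin x ^+ 2)^-1 <= (x ^+ 2)^-1 + 1.
Proof.
move=> /andP[x0 xpi].
have s0 : 0 < sin x by rewrite sin_gt0_pihalf// x0.
have c0 : 0 < cos x.
  by rewrite cos_gt0_pihalf// xpi andbT (lt_trans _ x0)// oppr_lt0 divr_gt0 ?pi_gt0.
have xs : sin x <= x by rewrite sin_le// ltW.
have xc : x * cos x <= sin x.
  rewrite mulr_cos_le_sin// ltW//=; have := @pi_gt0 R; lra.
have x2 : 0 < x ^+ 2 by rewrite exprn_gt0.
have s2 : 0 < sin x ^+ 2 by rewrite exprn_gt0.
apply/andP; split.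
  rewrite lef_pV2 ?posrE//.
  by rewrite lerXn2r ?nnegrE// ltW.
have h : x ^+ 2 * (1 - sin x ^+ 2) <= sin x ^+ 2.
  rewrite -cos2sin2 -exprMn lerXn2r ?nnegrE ?mulr_ge0// ltW//.
rewrite -(ler_pM2l x2) -(ler_pM2r s2) mulfVK ?gt_eqF// mulrDr mulfV ?gt_eqF//.
by move: h; set a := x ^+ 2; set b := sin x ^+ 2; nra.
Qed.

(** Divide [cos^2 + sin^2 = 1] at [x / 2] by [sin^2 x], where
    [sin x = 2 sin (x / 2) cos (x / 2)]; then read [cos (x / 2)] as
    [sin (pi / 2 - x / 2)]. *)
Lemma sin_sqrV_half (R : realType) (x : R) : 0 < x < pi ->
  (sin x ^+ 2)^-1 =
  4^-1 * ((sin (x / 2) ^+ 2)^-1 + (sin (pi / 2 - x / 2) ^+ 2)^-1).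
Proof.
move=> /andP[x0 xpi].
have s0 : sin (x / 2) != 0.
  by rewrite gt_eqF// sin_gt0_pihalf// divr_gt0//= ltr_pM2r.
have c0 : cos (x / 2) != 0.
  rewrite gt_eqF// cos_gt0_pihalf//; have := @pi_gt0 R; lra.
have -> : sin (pi / 2 - x / 2) = cos (x / 2).
  by rewrite sinB sin_pihalf cos_pihalf mul1r mul0r subr0.
have {1}-> : x = (x / 2) *+ 2 by rewrite -mulr_natr divfK.
rewrite sin_mulr2n.
have h := cos2Dsin2 (x / 2).
set c := cos _ in c0 h *; set s := sin _ in s0 h *.
rewrite -[LHS]mul1r -[X in X / _ = _]h; field.
by rewrite s0 c0.
Qed.

(** By [sin_sqrV_half], the term of index [k] at level [n] is a quarter of the
    sum of the terms of indices [k] and [2 ^ n.+1 - 1 - k] at level [n.+1]. *)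
Lemma sum_sin_sqrV (R : realType) (n : nat) :
  \sum_(k < 2 ^ n) (sin ((2 * k + 1)%:R * pi / (4 * 2 ^+ n)) ^+ 2)^-1
  = 2 * 4 ^+ n :> R.
Proof.
elim: n => [|n IHn].
  rewrite !expr0 !mulr1 big_ord1 mul1r.
  have -> : pi / 4 = (pi / 2) / 2 :> R by field.
  have pi2 := @pi_ge2 R.
  have := @sin_sqrV_half R (pi / 2); rewrite sin_pihalf expr1n invr1.
  have -> : pi / 2 - pi / 2 / 2 = pi / 2 / 2 :> R by field.
  have pi01 : 0 < (pi / 2 : R) < pi by lra.
  by move=> /(_ pi01); lra.
rewrite expnS mul2n -addnn big_split_ord /=.
rewrite [X in _ + X](reindex_inj rev_ord_inj) /= -big_split /=.
rewrite [in RHS]exprS mulrCA -IHn mulr_sumr; apply: eq_bigr => k _.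
have kn := ltn_ord k.
have E0 : 0 < (2 : R) ^+ n by rewrite exprn_gt0.
have kR : (2 * k + 1)%:R <= 2 * 2 ^+ n :> R.
  by rewrite -natrX -natrM ler_nat; lia.
set x := (2 * k + 1)%:R * pi / (4 * 2 ^+ n).
have x01 : 0 < x < pi.
  have k0 : 0 < (2 * k + 1)%:R :> R by rewrite ltr0n addn1.
  rewrite /x !(mulr_gt0, invr_gt0) ?pi_gt0//=.
  rewrite ltr_pdivrMr ?mulr_gt0// [X in _ < X]mulrC ltr_pM2r ?pi_gt0//.
  by apply: le_lt_trans kR _; lra.
rewrite [in RHS](sin_sqrV_half x01) mulrA mulfV// mul1r.
congr ((sin _ ^+ 2)^-1 + (sin _ ^+ 2)^-1).
  by rewrite /x exprS; field; rewrite gt_eqF.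
rewrite /x exprS.
have -> : (2 * (2 ^ n + (2 ^ n - k.+1)) + 1)%:R = 4 * 2 ^+ n - (2 * k + 1)%:R :> R.
  apply/eqP; rewrite eq_sym subr_eq -natrX -natrM -natrD; apply/eqP.
  by congr _%:R; lia.
by field; rewrite gt_eqF.
Qed.

(** Replacing [1 / sin^2 x] by [1 / x^2] in [sum_sin_sqrV] costs at most 1 for
    each of the [2 ^ n] terms, while the sum is of order [4 ^ n]. *)
Lemma sum_odd_sqrV_bounds (R : realType) (n : nat) :
  (pi : R) ^+ 2 / 8 - pi ^+ 2 / (16 * 2 ^+ n)
    <= \sum_(k < 2 ^ n) ((2 * k + 1)%:R ^+ 2)^-1 <= (pi : R) ^+ 2 / 8.
Proof.
set O := \sum_(k < _) _.
have E0 : 0 < (2 : R) ^+ n by rewrite exprn_gt0.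
have pi0 : 0 < (pi : R) ^+ 2 by rewrite exprn_gt0// pi_gt0.
have p2 := @pi_gt0 R.
have h := @sum_sin_sqrV R n.
have th (k : 'I_(2 ^ n)) :
    0 < (2 * k + 1)%:R * (pi : R) / (4 * 2 ^+ n) < pi / 2.
  have k0 : 0 < (2 * k + 1)%:R :> R by rewrite ltr0n addn1.
  rewrite !(mulr_gt0, invr_gt0) ?pi_gt0//=.
  rewrite ltr_pdivrMr ?mulr_gt0//.
  have -> : pi / 2 * (4 * 2 ^+ n) = (2 * 2 ^+ n) * pi :> R by field.
  rewrite ltr_pM2r// -natrX -natrM ltr_nat.
  by have := ltn_ord k; lia.
have OE : \sum_(k < 2 ^ n) (((2 * k + 1)%:R * pi / (4 * 2 ^+ n)) ^+ 2)^-1 =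
    16 * (2 ^+ n) ^+ 2 / pi ^+ 2 * O.
  rewrite /O mulr_sumr; apply: eq_bigr => k _.
  have k0 : (2 * k + 1)%:R != 0 :> R by rewrite pnatr_eq0 addn1.
  move: k0 (gt_eqF E0) (gt_eqF p2).
  move: (2 * k + 1)%:R (2 ^+ n) (pi : R) => a b p a0 b0 q0; field.
  by rewrite a0 b0 q0.
have h1 : 16 * (2 ^+ n) ^+ 2 / pi ^+ 2 * O <= 2 * 4 ^+ n.
  rewrite -OE -h; apply: ler_sum => k _.
  by case/andP: (sin_sqrV_bounds (th k)).
have h2 : 2 * 4 ^+ n <= 16 * (2 ^+ n) ^+ 2 / pi ^+ 2 * O + 2 ^+ n.
  have E1 : (2 : R) ^+ n = \sum_(k < 2 ^ n) 1.
    by rewrite sumr_const card_ord natrX.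
  rewrite -OE -h [X in _ + X]E1 -big_split /=; apply: ler_sum => k _.
  by case/andP: (sin_sqrV_bounds (th k)).
have E4 : (4 : R) ^+ n = (2 ^+ n) ^+ 2.
  by rewrite -exprM mulnC exprM -(natrX _ 2 2).
rewrite E4 in h1 h2.
set M := 2 ^+ n in E0 h1 h2 *; set p := pi ^+ 2 in pi0 h1 h2 *.
have pn : p != 0 by rewrite gt_eqF.
have Mn : M != 0 by rewrite gt_eqF.
have M2 : 0 < M ^+ 2 by rewrite exprn_gt0.
have h3 : 16 * M ^+ 2 / p * O <= 16 * M ^+ 2 / p * (p / 8).
  by apply: le_trans h1 _; rewrite le_eqVlt; apply/orP; left; apply/eqP; field.
have h4 : 16 * M ^+ 2 / p * (p / 8 - p / (16 * M)) <= 16 * M ^+ 2 / p * O.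
  rewrite -(lerD2r M); apply: le_trans h2.
  by rewrite le_eqVlt; apply/orP; left; apply/eqP; field; rewrite Mn.
have c0 : 0 < 16 * M ^+ 2 / p by rewrite !(mulr_gt0, invr_gt0).
by move: h3 h4; rewrite !(ler_pM2l c0) => -> ->.
Qed.

Lemma sum_sqrV_even_odd (R : realType) (m : nat) :
  \sum_(k < 2 * m) (k.+1%:R ^+ 2)^-1 =
  \sum_(k < m) ((2 * k + 1)%:R ^+ 2)^-1 + 4^-1 * \sum_(k < m) (k.+1%:R ^+ 2)^-1
  :> R.
Proof.
elim: m => [|m IHm]; first by rewrite !big_ord0 mulr0 addr0.
have -> : (2 * m.+1 = (2 * m).+2)%N by lia.
rewrite !big_ord_recr/= IHm addn1 mulrDr.
have -> : ((2 * m).+2%:R ^+ 2)^-1 = 4^-1 * (m.+1%:R ^+ 2)^-1 :> R.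
  rewrite -invfM (_ : (2 * m).+2%:R = 2 * m.+1%:R) ?exprMn -?(natrX _ 2 2)//.
  by rewrite -natrM; congr _%:R; lia.
by rewrite !addrA; congr (_ + _); rewrite -!addrA; congr (_ + _); rewrite addrC.
Qed.

Lemma sum_sqrV_doubling (R : realType) (m : nat) : (0 < m)%N ->
  \sum_(k < 2 * m) (k.+1%:R ^+ 2)^-1 <=
  \sum_(k < m) (k.+1%:R ^+ 2)^-1 + m%:R^-1 :> R.
Proof.
move=> m0; have mR : 0 < m%:R :> R by rewrite ltr0n.
rewrite mul2n -addnn big_split_ord /= lerD2l.
apply: (@le_trans _ _ (\sum_(k < m) (m%:R ^+ 2)^-1 : R)).
  apply: ler_sum => k _; rewrite lef_pV2 ?posrE ?exprn_gt0 ?ltr0n//.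
  by rewrite lerXn2r ?nnegrE ?ler0n// ler_nat; lia.
rewrite sumr_const card_ord -[X in X <= _]mulr_natl.
by rewrite expr2 invfM mulrA mulfV ?mul1r// gt_eqF.
Qed.

Lemma sum_sqrV_nondecreasing (R : realType) (m n : nat) : (m <= n)%N ->
  \sum_(k < m) (k.+1%:R ^+ 2)^-1 <= \sum_(k < n) (k.+1%:R ^+ 2)^-1 :> R.
Proof.
move=> mn; rewrite -(subnKC mn) big_split_ord/= lerDl.
by apply: sumr_ge0 => k _; rewrite invr_ge0 exprn_ge0.
Qed.

(** Let [S m] and [O m] be the sums of the [m] first inverse squares of all
    and of odd numbers. Then [S (2 m) = O m + S m / 4], and [S m <= S (2 m)]
    gives [S m <= 4 / 3 * O m]. *)
Lemma sum_sqrV_le (R : realType) (n : nat) :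
  \sum_(k < n) (k.+1%:R ^+ 2)^-1 <= (pi : R) ^+ 2 / 6.
Proof.
have nm : (n <= 2 ^ n)%N by rewrite ltnW// ltn_expl.
apply: le_trans (sum_sqrV_nondecreasing R nm) _.
have := sum_sqrV_even_odd R (2 ^ n).
have mm : (2 ^ n <= 2 * 2 ^ n)%N by rewrite leq_pmull.
have := sum_sqrV_nondecreasing R mm.
have /andP[_] := sum_odd_sqrV_bounds R n.
lra.
Qed.

(** The relation [S (2 m) = O m + S m / 4] is now used with
    [S (2 m) <= S m + 1 / m]. The rate [1 / n] matters: the partition
    recursion uses this sum with about [sqrt m] terms and multiplies it by
    [m]. *)
Lemma sum_sqrV_ge (R : realType) (n : nat) : (0 < n)%N ->
  (pi : R) ^+ 2 / 6 - 6 / n%:R <= \sum_(k < n) (k.+1%:R ^+ 2)^-1.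
Proof.
move=> n0; have nR : 0 < n%:R :> R by rewrite ltr0n.
have /andP[mn nm] : (2 ^ trunc_log 2 n <= n < 2 * 2 ^ trunc_log 2 n)%N.
  by rewrite trunc_logP//= -expnS trunc_log_ltn.
set m := trunc_log 2 n in mn nm.
apply: le_trans (sum_sqrV_nondecreasing R mn).
have M0 : (0 < 2 ^ m)%N by rewrite expn_gt0.
have h1 := sum_sqrV_doubling R M0.
have h2 := sum_sqrV_even_odd R (2 ^ m).
have /andP[h3 _] := sum_odd_sqrV_bounds R m.
have MR : 0 < 2 ^+ m :> R by rewrite exprn_gt0.
rewrite natrX in h1.
have h4 : (2 ^+ m)^-1 <= 2 / n%:R :> R.
  rewrite -[X in X <= _]mul1r ler_pdivrMr// mulrAC ler_pdivlMr// mul1r.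
  by rewrite -natrX -natrM ler_nat ltnW.
have pi4 : (pi : R) ^+ 2 / (16 * 2 ^+ m) <= (2 ^+ m)^-1.
  have p2 := @pi_gt0 R; have p4 := @pihalf_lt2 R.
  have i0 : 0 <= (2 ^+ m)^-1 :> R by rewrite invr_ge0 ltW.
  rewrite invfM mulrA ler_piMl// ler_pdivrMr// mul1r.
  by rewrite expr2; nra.
set q := _ / (_ * _) in h3 pi4.
have -> : 6 / n%:R = 3 * (2 / n%:R) :> R by ring.
set u := 2 / n%:R in h4 *; set v := (2 ^+ m)^-1 in h1 h4 pi4.
set S2 := \sum_(k < 2 * 2 ^ m) _ in h1 h2.
set S := \sum_(k < 2 ^ m) (k.+1%:R ^+ 2)^-1 in h1 h2 *.
set O := \sum_(k < 2 ^ m) _ in h2 h3.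
have u0 : 0 <= u by rewrite divr_ge0 ?ltW.
move: h1 h2 h3 h4 pi4 u0; clearbody S2 S O q u v.
by move: (pi ^+ 2) => p; lra.
Qed.

(** * Sums of powers against a geometric progression *)

(** That is, [2 sinh (x / 2) >= x]. *)
Lemma mulr_expR_half_le (R : realType) (x : R) : 0 <= x ->
  x * expR (x / 2) <= expR x - 1.
Proof.
move=> x0; have x20 : 0 <= x / 2 by rewrite divr_ge0.
have := @ler_of_derive_ge0 R
  (fun y => expR y ^+ 2 - 1 - 2 * (y * expR y))
  (fun y => 2 * expR y * (expR y - (1 + y))) (x / 2) x20.
rewrite expR0 !expr1n mul0r mulr0 subrr subr0 -expRM_natr divfK// subr_ge0.
rewrite mulrA mulrCA divff// mulr1; apply.
  move=> y; apply: is_derive_eq; rewrite /GRing.scale /=; ring.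
move=> y _; rewrite mulr_ge0 ?mulr_ge0 ?expR_ge0// subr_ge0; exact: expR_ge1Dx.
Qed.

(** The Pade approximant [(2 + x) / (2 - x)] of the exponential is an upper
    bound; it yields the lower bound [expR_kernel_ge] without any power
    series. *)
Lemma mulr_expR_le_pade (R : realType) (x : R) : 0 <= x ->
  (2 - x) * expR x <= 2 + x.
Proof.
move=> x0.
have := @ler_of_derive_ge0 R
  (fun y => 2 + y - (2 - y) * expR y)
  (fun y => 1 - (1 - y) * expR y) x x0.
rewrite expR0 !subr0 addr0 mulr1 subrr subr_ge0; apply.
  move=> y; apply: is_derive_eq; rewrite /GRing.scale /=; ring.
move=> y _; rewrite subr_ge0 -[X in _ <= X](expRxMexpNx_1 y) mulrC.
by rewrite ler_pM2l ?expR_gt0//; exact: expR_ge1Dx.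
Qed.

Lemma expRN_lt1 (R : realType) (x : R) : 0 < x -> 0 < expR (- x) < 1.
Proof. by move=> x0; rewrite expR_gt0 expR_lt1 oppr_lt0. Qed.

(** The kernel is [1 / (4 sinh^2 (x / 2))], the sum of [v * exp (- v x)] over
    [v >= 1]. *)
Lemma expR_kernel_le (R : realType) (x : R) : 0 < x ->
  expR (- x) / (1 - expR (- x)) ^+ 2 <= (x ^+ 2)^-1.
Proof.
move=> x0; have /andP[q0 q1] := expRN_lt1 x0.
have h := mulr_expR_half_le (ltW x0).
have hq : expR (- x) = expR (- (x / 2)) ^+ 2.
  by rewrite -expRM_natr mulNr divfK.
have h2 : x * expR (- (x / 2)) <= 1 - expR (- x).
  rewrite -(ler_pM2l (expR_gt0 x)) mulrBr mulr1 expRxMexpNx_1 mulrCA -expRD.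
  by have -> : x - x / 2 = x / 2 by field.
rewrite ler_pdivrMr ?exprn_gt0 ?subr_gt0// mulrC ler_pdivlMr ?exprn_gt0//.
rewrite {1}hq mulrC -exprMn lerXn2r ?nnegrE ?subr_ge0//; last exact: ltW.
by rewrite mulr_ge0 ?expR_ge0// ltW.
Qed.

(** The error stays bounded as [x] tends to 0, so that it contributes only
    [O(sqrt m)] when summed over about [sqrt m] values of [x]. *)
Lemma expR_kernel_ge (R : realType) (x : R) : 0 < x ->
  (x ^+ 2)^-1 - 4^-1 <= expR (- x) / (1 - expR (- x)) ^+ 2.
Proof.
move=> x0; have /andP[q0 q1] := expRN_lt1 x0.
have x2 : 0 < x ^+ 2 by rewrite exprn_gt0.
have [xge|xlt] := leP 2 x.
  apply: (@le_trans _ _ 0); last first.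
    by rewrite divr_ge0 ?exprn_ge0 ?subr_ge0// ltW.
  rewrite subr_le0 lef_pV2 ?posrE//.
  have -> : 4 = 2 ^+ 2 :> R by rewrite -natrX.
  by rewrite lerXn2r ?nnegrE// ltW.
have h : (2 - x) <= (2 + x) * expR (- x).
  have := mulr_expR_le_pade (ltW x0).
  rewrite -(ler_pM2r q0) -mulrA expRxMexpNx_1 mulr1; exact.
set q := expR (- x) in q0 q1 h *.
have d0 : 0 < (1 - q) ^+ 2 by rewrite exprn_gt0// subr_gt0.
rewrite ler_pdivlMr// -(ler_pM2l x2) mulrA mulrBr mulfV ?gt_eqF//.
have k1 : (1 - q) * (2 + x) <= 2 * x by lra.
have k2 : ((1 - q) * (2 + x)) ^+ 2 <= (2 * x) ^+ 2.
  by rewrite lerXn2r ?nnegrE// mulr_ge0//; lra.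
have k3 : (2 - x) * ((1 - q) * (2 + x)) ^+ 2 <= (2 + x) * q * (2 * x) ^+ 2.
  by apply: ler_pM => //; [lra | rewrite exprn_ge0// mulr_ge0//; lra].
have p0 : 0 < 2 + x by lra.
rewrite -(ler_pM2l p0).
have -> : (2 + x) * ((1 - x ^+ 2 / 4) * (1 - q) ^+ 2) =
  (2 - x) * ((1 - q) * (2 + x)) ^+ 2 / 4 by field.
rewrite ler_pdivrMr//.
by have -> : (2 + x) * (x ^+ 2 * q) * 4 = (2 + x) * q * (2 * x) ^+ 2 by ring.
Qed.

Lemma sum_arith_geom (R : fieldType) (q : R) (W : nat) : 1 - q != 0 ->
  \sum_(v < W) v.+1%:R * q ^+ v.+1 =
  (q - W.+1%:R * q ^+ W.+1 + W%:R * q ^+ W.+2) / (1 - q) ^+ 2.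
Proof.
move=> q1; elim: W => [|W IHW].
  by rewrite big_ord0 expr1 mul1r subrr mul0r add0r mul0r.
rewrite big_ord_recr/= IHW -[X in _ + X](mulfK (x := (1 - q) ^+ 2)) ?expf_neq0//.
rewrite -mulrDl; congr (_ / _); rewrite !exprS -!natr1; ring.
Qed.

Lemma sum_arith_geom_le (R : realType) (x : R) (W : nat) : 0 < x ->
  \sum_(v < W) v.+1%:R * expR (- x) ^+ v.+1 <= (x ^+ 2)^-1.
Proof.
move=> x0; have /andP[q0 q1] := expRN_lt1 x0.
apply: le_trans (expR_kernel_le x0).
rewrite sum_arith_geom; last by rewrite gt_eqF// subr_gt0.
rewrite ler_pM2r ?invr_gt0 ?exprn_gt0 ?subr_gt0//.
set q := expR (- x) in q0 q1 *.
have p0 : 0 <= q ^+ W.+1 by rewrite exprn_ge0// ltW.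
rewrite -addrA gerDl addrC subr_le0 [q ^+ W.+2]exprSr mulrA.
apply: (@le_trans _ _ (W%:R * q ^+ W.+1)).
  by rewrite ler_piMr ?mulr_ge0// ltW.
by rewrite ler_wpM2r// ler_nat.
Qed.

Lemma sum_arith_geom_ge (R : realType) (x : R) (W : nat) : 0 < x ->
  (x ^+ 2)^-1 - 4^-1 - W.+1%:R * expR (- x) ^+ W / x ^+ 2 <=
  \sum_(v < W) v.+1%:R * expR (- x) ^+ v.+1.
Proof.
move=> x0; have /andP[q0 q1] := expRN_lt1 x0.
have h1 := expR_kernel_ge x0; have h2 := expR_kernel_le x0.
rewrite sum_arith_geom; last by rewrite gt_eqF// subr_gt0.
set q := expR (- x) in q0 q1 h1 h2 *.
have d0 : 0 < (1 - q) ^+ 2 by rewrite exprn_gt0// subr_gt0.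
have -> : (q - W.+1%:R * q ^+ W.+1 + W%:R * q ^+ W.+2) / (1 - q) ^+ 2 =
  q / (1 - q) ^+ 2 - W.+1%:R * q ^+ W * (q / (1 - q) ^+ 2)
  + W%:R * q ^+ W.+2 / (1 - q) ^+ 2.
  by rewrite !mulrDl mulNr [q ^+ W.+1]exprSr !mulrA.
have t1 : W.+1%:R * q ^+ W * (q / (1 - q) ^+ 2) <= W.+1%:R * q ^+ W / x ^+ 2.
  by rewrite ler_wpM2l// mulr_ge0// exprn_ge0// ltW.
have t2 : 0 <= W%:R * q ^+ W.+2 / (1 - q) ^+ 2.
  by rewrite divr_ge0 ?(ltW d0)// mulr_ge0// exprn_ge0// ltW.
move: h1 t1 t2; set a := _ / _; set b := _ * a; set d := _ / (1 - q) ^+ 2.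
set e := _ / x ^+ 2; set f := _^-1.
clearbody a b d e f; lra.
Qed.

(** Half of the exponent absorbs the power of [v.+1], the other half is left
    to a geometric series. *)
Lemma sum_pow_geom_le (R : realType) (x : R) (m W : nat) : 0 < x ->
  \sum_(v < W) v.+1%:R ^+ m.+1 * expR (- x) ^+ v.+1 <=
  (m.+1)`!%:R * 2 ^+ m.+2 / x ^+ m.+2.
Proof.
move=> x0; have x20 : 0 < x / 2 by rewrite divr_gt0.
have /andP[r0 r1] := expRN_lt1 x20.
set r := expR (- (x / 2)) in r0 r1.
have qr : expR (- x) = r ^+ 2 by rewrite /r -expRM_natr mulNr divfK.
have f0 : 0 < (m.+1)`!%:R :> R by rewrite ltr0n fact_gt0.
have term (v : nat) : v.+1%:R ^+ m.+1 * expR (- x) ^+ v.+1 <=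
    (m.+1)`!%:R * (2 / x) ^+ m.+1 * r ^+ v.+1.
  rewrite qr -exprM mulnC exprM expr2 mulrA ler_pM2r ?exprn_gt0//.
  have y0 : 0 <= v.+1%:R * (x / 2) by rewrite mulr_ge0// ltW.
  have h := expR_ge1Dxn m y0.
  have h' : (v.+1%:R * (x / 2)) ^+ m.+1 / (m.+1)`!%:R <= expR (x / 2) ^+ v.+1.
    by rewrite -expRM_natl; apply: le_trans h; rewrite lerDr.
  have h2 : v.+1%:R ^+ m.+1 <= (m.+1)`!%:R * (2 / x) ^+ m.+1 * expR (x / 2) ^+ v.+1.
    have e0 : 0 < (m.+1)`!%:R * (2 / x) ^+ m.+1.
      by rewrite mulr_gt0// exprn_gt0// divr_gt0.
    apply: le_trans (ler_wpM2l (ltW e0) h').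
    rewrite [X in _ <= X]mulrC [X in _ <= X]mulrA divfK ?gt_eqF// -exprMn.
    have -> : v.+1%:R * (x / 2) * (2 / x) = v.+1%:R.
      by rewrite -mulrA (_ : x / 2 * (2 / x) = 1) ?mulr1//; field; rewrite gt_eqF.
    exact: lexx.
  have h3 : expR (x / 2) ^+ v.+1 * r ^+ v.+1 = 1.
    by rewrite -exprMn expRxMexpNx_1 expr1n.
  move: h2; rewrite -(@ler_pM2r _ (r ^+ v.+1)) ?exprn_gt0//.
  by rewrite -[X in _ <= X -> _]mulrA h3 mulr1.
apply: (@le_trans _ _ (\sum_(v < W) (m.+1)`!%:R * (2 / x) ^+ m.+1 * r ^+ v.+1)).
  by apply: ler_sum => v _; exact: term.
rewrite -mulr_sumr.
have geo : \sum_(v < W) r ^+ v.+1 <= 2 / x.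
  have -> : \sum_(v < W) r ^+ v.+1 = (r - r ^+ W.+1) / (1 - r).
    elim: (W) => [|w IHw]; first by rewrite big_ord0 expr1 subrr mul0r.
    rewrite big_ord_recr/= IHw -[X in _ + X](mulfK (x := 1 - r)) ?gt_eqF ?subr_gt0//.
    by rewrite -mulrDl; congr (_ / _); rewrite !exprS; ring.
  rewrite ler_pdivrMr ?subr_gt0//.
  have h : (x / 2) * r <= 1 - r.
    have := expR_ge1Dx (x / 2); rewrite -(ler_pM2r r0) expRxMexpNx_1; lra.
  apply: (@le_trans _ _ r); first by rewrite gerBl exprn_ge0// ltW.
  move: h; rewrite -(@ler_pM2l _ (2 / x)) ?divr_gt0//.
  by rewrite mulrA (_ : 2 / x * (x / 2) = 1) ?mul1r//; field; rewrite gt_eqF.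
have e0 : 0 <= (m.+1)`!%:R * (2 / x) ^+ m.+1.
  by rewrite mulr_ge0// exprn_ge0// divr_ge0 ?ltW.
apply: (le_trans (ler_wpM2l e0 geo)).
by rewrite -[X in _ <= X]mulrA -expr_div_n -mulrA -exprSr.
Qed.

(** * Integer partitions and Erdos' recursion *)

(** A partition into parts of size at most [N], each occurring at most [N]
    times: the value at [i] is the number of parts equal to [i.+1]. All
    partitions of [m] are of this form if [m <= N]. *)
Notation multiplicities N := {ffun 'I_N -> 'I_N.+1}.

Definition weight (N : nat) (f : multiplicities N) : nat :=
  (\sum_(i < N) i.+1 * f i)%N.

Definition partitions_of (N m : nat) : {set multiplicities N} :=
  [set f | weight f == m].

Definition add_parts (N : nat) (i : 'I_N) (k : nat)
    (f : multiplicities N) : multiplicities N :=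
  [ffun j => if j == i then inord (f i + k) else f j].

Lemma leq_weight (N : nat) (f : multiplicities N) (i : 'I_N) :
  (i.+1 * f i <= weight f)%N.
Proof. by rewrite /weight (bigD1 i)//= leq_addr. Qed.

Lemma weight_add_parts (N : nat) (f : multiplicities N) (i : 'I_N)
    (k : nat) : (f i + k <= N)%N ->
  weight (add_parts i k f) = (weight f + k * i.+1)%N.
Proof.
move=> fk; rewrite /weight (bigD1 i)//= [in RHS](bigD1 i)//= ffunE eqxx.
rewrite inordK ?ltnS// mulnDr [(k * _)%N]mulnC addnAC; congr (_ + _ + _)%N.
by apply: eq_bigr => j ji; rewrite ffunE (negbTE ji).
Qed.

(** Remove [k] copies of the part [i.+1]. *)
Lemma card_partitions_with_parts (N m : nat) (i : 'I_N) (k : nat) : (m <= N)%N ->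
  #|[set f in partitions_of N m | k <= f i]%N| =
  if (k * i.+1 <= m)%N then #|partitions_of N (m - k * i.+1)| else 0%N.
Proof.
move=> mN; case: leqP => km; last first.
  apply/eqP; rewrite cards_eq0; apply/eqP/setP => f; rewrite !inE.
  apply/negbTE/negP => /andP[/eqP fm kf]; move: km; rewrite ltnNge => /negP[].
  by rewrite mulnC -fm (leq_trans _ (leq_weight f i))// leq_mul.
have small (f : multiplicities N) :
    f \in partitions_of N (m - k * i.+1) -> (f i + k <= N)%N.
  rewrite inE => /eqP fm; have := leq_weight f i; rewrite fm.
  have : (f i <= i.+1 * f i)%N by rewrite leq_pmull.
  have : (k <= k * i.+1)%N by rewrite leq_pmulr.
  by lia.
have -> : [set f in partitions_of N m | (k <= f i)%N] =
    add_parts i k @: partitions_of N (m - k * i.+1).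
  apply/setP => f; apply/idP/imsetP => [|[g gm ->]].
    rewrite !inE => /andP[/eqP fm kf].
    pose g : multiplicities N :=
      [ffun j => if j == i then inord (f i - k) else f j].
    have gi : g i = (f i - k)%N :> nat.
      by rewrite ffunE eqxx inordK// ltnS (leq_trans (leq_subr _ _))// -ltnS.
    have fg : f = add_parts i k g.
      apply/ffunP => j; rewrite ffunE; case: eqP => [->|/eqP ji].
        by apply: val_inj => /=; rewrite gi subnK// inordK.
      by rewrite ffunE (negbTE ji).
    exists g => //; rewrite inE.
    have gk : (g i + k <= N)%N by rewrite gi subnK// -ltnS.
    by have := weight_add_parts gk; rewrite -fg fm => ->; rewrite addnK.
  have gN := small _ gm; rewrite !inE weight_add_parts//.
  move: gm; rewrite inE => /eqP ->; rewrite subnK// eqxx/= ffunE eqxx.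
  by rewrite inordK ?ltnS// leq_addl.
rewrite card_in_imset// => f g fm gm fg; apply/ffunP => j.
have := congr1 (fun h : multiplicities N => h j) fg; rewrite !ffunE.
case: eqP => [->|//] /(congr1 val)/=.
rewrite !inordK ?ltnS ?small// => /eqP; rewrite eqn_add2r => /eqP.
exact: val_inj.
Qed.

Lemma sum_ltn_indicator (a N : nat) : (a <= N)%N ->
  (\sum_(k < N) (k < a) = a)%N.
Proof.
move=> aN; rewrite -(subnKC aN) big_split_ord /=.
rewrite [X in (_ + X)%N]big1 ?addn0; last first.
  by move=> k _; rewrite ltnNge leq_addr.
rewrite -[RHS](card_ord a) -sum1_card; apply: eq_bigr => k _.
by rewrite ltn_ord.
Qed.

(** Both sides add up the sizes of all the parts of all the partitions of [m]:
    on the right, [i.+1] is counted once for each [k] such that there are at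
    least [k.+1] parts of this size. *)
Lemma partitions_recursion (N m : nat) : (m <= N)%N ->
  (m * #|partitions_of N m| =
   \sum_(k < N) \sum_(i < N) i.+1 *
     if k.+1 * i.+1 <= m then #|partitions_of N (m - k.+1 * i.+1)| else 0)%N.
Proof.
move=> mN; rewrite exchange_big /=.
transitivity (\sum_(f in partitions_of N m) weight f)%N.
  rewrite mulnC -sum_nat_const; apply: eq_bigr => f.
  by rewrite inE => /eqP.
rewrite /weight exchange_big /=; apply: eq_bigr => i _.
rewrite -!big_distrr /=; congr muln.
transitivity (\sum_(f in partitions_of N m) \sum_(k < N) (k < f i))%N.
  by apply: eq_bigr => f _; rewrite sum_ltn_indicator// -ltnS.
rewrite exchange_big /=; apply: eq_bigr => k _.
rewrite -card_partitions_with_parts// -sum1_card big_mkcond /=.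
rewrite [RHS]big_mkcond; apply: eq_bigr => f _; rewrite !inE.
by case: (_ == m); case: ltnP.
Qed.

Lemma card_partitions0 (N : nat) : #|partitions_of N 0| = 1%N.
Proof.
apply/eqP/cards1P; exists [ffun=> ord0]; apply/setP => f; rewrite !inE.
apply/idP/eqP => [|->]; last first.
  by rewrite /weight big1// => i _; rewrite ffunE muln0.
rewrite /weight sum_nat_eq0 => /forallP f0; apply/ffunP => i; rewrite ffunE.
by apply: val_inj; have := f0 i; rewrite /= muln_eq0 => /eqP.
Qed.

Lemma card_partitions_gt0 (N m : nat) : (m <= N)%N ->
  (0 < #|partitions_of N m|)%N.
Proof.
case: m => [|m] mN; first by rewrite card_partitions0.
have := card_partitions_with_parts (Ordinal mN) 1 mN.
rewrite mul1n leqnn subnn card_partitions0 => h.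
by rewrite -h subset_leq_card//; apply/fintype.subsetP => f; rewrite inE => /andP[].
Qed.

Lemma card_partitions_large_part (N m K : nat) : (m <= N)%N ->
  (#|[set f in partitions_of N m | [exists i : 'I_N, (K <= i) && (0 < f i)]]|
   <= \sum_(i < N | K <= i)
        if i < m then #|partitions_of N (m - i.+1)| else 0)%N.
Proof.
move=> mN.
have -> : (\sum_(i < N | K <= i)
    (if i < m then #|partitions_of N (m - i.+1)| else 0) =
    \sum_(f in partitions_of N m) \sum_(i < N | K <= i) (0 < f i))%N.
  rewrite exchange_big /=; apply: eq_bigr => i _.
  have := card_partitions_with_parts i 1 mN; rewrite mul1n => <-.
  rewrite -sum1_card big_mkcond /= [RHS]big_mkcond; apply: eq_bigr => f _.
  by rewrite !inE; case: (_ == m); case: ltnP.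
rewrite -sum1_card big_mkcond /= [X in (_ <= X)%N]big_mkcond; apply: leq_sum => f _.
rewrite !inE; case: (_ == m) => //=; case: existsP => // -[i /andP[Ki fi]].
by rewrite (bigD1 i)//= fi.
Qed.

(** * The upper bound for the number of integer partitions *)

Lemma sqrt_le_of_sqr (R : realType) (x y : R) :
  0 <= y -> x <= y ^+ 2 -> Num.sqrt x <= y.
Proof.
by move=> y0 xy; rewrite -(ger0_norm y0) -sqrtr_sqr ler_wsqrtr.
Qed.

Lemma le_sqrt_of_sqr (R : realType) (x y : R) :
  0 <= y -> y ^+ 2 <= x -> y <= Num.sqrt x.
Proof.
by move=> y0 xy; rewrite -(ger0_norm y0) -sqrtr_sqr ler_wsqrtr.
Qed.

Lemma sqrt_sub_le (R : realType) (x y : R) : 0 < x -> y <= x ->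
  Num.sqrt (x - y) <= Num.sqrt x - y / (2 * Num.sqrt x).
Proof.
move=> x0 yx; have s0 : 0 < Num.sqrt x by rewrite sqrtr_gt0.
have sx : Num.sqrt x ^+ 2 = x by rewrite sqr_sqrtr// ltW.
set s := Num.sqrt x in s0 sx *.
have sE : s - y / (2 * s) = (2 * x - y) / (2 * s).
  by rewrite -sx; field; rewrite gt_eqF.
apply: sqrt_le_of_sqr; first by rewrite sE divr_ge0//; lra.
have -> : (s - y / (2 * s)) ^+ 2 = x - y + (y / (2 * s)) ^+ 2.
  by rewrite -sx; field; rewrite gt_eqF.
by rewrite lerDl sqr_ge0.
Qed.

Lemma sqrt_sub_ge (R : realType) (x y : R) : 0 < x -> 0 <= y <= x ->
  Num.sqrt x - y / (2 * Num.sqrt x) - y ^+ 2 / (2 * Num.sqrt x * x)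
    <= Num.sqrt (x - y).
Proof.
move=> x0 /andP[y0 yx]; have s0 : 0 < Num.sqrt x by rewrite sqrtr_gt0.
have sx : Num.sqrt x ^+ 2 = x by rewrite sqr_sqrtr// ltW.
have [u [u0 u1 ->]] : exists u, [/\ 0 <= u, u <= 1 & y = u * x].
  exists (y / x); split; last by rewrite divfK// gt_eqF.
    by rewrite divr_ge0// ltW.
  by rewrite ler_pdivrMr// mul1r.
have -> : x - u * x = x * (1 - u) by ring.
set s := Num.sqrt x in s0 sx *.
have -> : s - u * x / (2 * s) - (u * x) ^+ 2 / (2 * s * x) =
    s * ((1 - u) * (1 + u / 2)).
  by rewrite -sx; field; rewrite gt_eqF.
apply: le_sqrt_of_sqr; first by rewrite !mulr_ge0//; lra.
rewrite exprMn sx ler_pM2l// exprMn.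
have -> : (1 - u) ^+ 2 * (1 + u / 2) ^+ 2 =
    (1 - u) * ((1 - u) * (1 + u / 2) ^+ 2) by ring.
rewrite ler_piMr ?subr_ge0//.
have -> : (1 - u) * (1 + u / 2) ^+ 2 = 1 - u ^+ 2 * (3 + u) / 4 by field.
by rewrite gerBl divr_ge0// mulr_ge0 ?sqr_ge0//; lra.
Qed.

Lemma bernoulli_ineq (R : realType) (z : R) (n : nat) : 0 <= z ->
  1 + n%:R * z <= (1 + z) ^+ n.
Proof.
move=> z0; elim: n => [|n IHn]; first by rewrite mul0r addr0.
have n0 : 0 <= n%:R :> R by [].
rewrite exprS -natr1; apply: (@le_trans _ _ ((1 + z) * (1 + n%:R * z))).
  by have := mulr_ge0 n0 (mulr_ge0 z0 z0); lra.
by rewrite ler_wpM2l//; lra.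
Qed.

Lemma ler_sum_ord_widen (R : realType) (m n : nat) (F : nat -> R) :
  (m <= n)%N -> (forall k, 0 <= F k) -> \sum_(k < m) F k <= \sum_(k < n) F k.
Proof.
move=> mn F0; rewrite -(subnKC mn) big_split_ord/= lerDl.
by apply: sumr_ge0 => k _; exact: F0.
Qed.

(** The constant in the Hardy-Ramanujan formula. *)
Definition hardy_ramanujan (R : realType) : R := pi * Num.sqrt (2 / 3).

Lemma hardy_ramanujan_gt0 (R : realType) : 0 < hardy_ramanujan R.
Proof. by rewrite mulr_gt0 ?pi_gt0// sqrtr_gt0 divr_gt0. Qed.

Lemma hardy_ramanujan_sqr (R : realType) :
  hardy_ramanujan R ^+ 2 = 4 * (pi ^+ 2 / 6).
Proof. by rewrite exprMn sqr_sqrtr ?divr_ge0//; field. Qed.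

Lemma pi_sqr_ge6 (R : realType) : 1 <= (pi : R) ^+ 2 / 6.
Proof. by have := sum_sqrV_le R 1; rewrite big_ord1 expr1n invr1. Qed.

Lemma hardy_ramanujan_ge2 (R : realType) : 2 <= hardy_ramanujan R.
Proof.
rewrite -(@ler_pXn2r _ 2)// ?nnegrE ?(ltW (hardy_ramanujan_gt0 R))//.
rewrite hardy_ramanujan_sqr -natrX.
by have := pi_sqr_ge6 R; set p := _ / 6; lra.
Qed.

(** The value of [t] that minimises [pi ^+ 2 / (6 * t) + m%:R * t], which
    approximates the logarithm of the generating function of partitions at
    [expR (- t)] divided by its [m]-th monomial; it is also the derivative of
    [hardy_ramanujan R * Num.sqrt x] at [m]. *)
Definition saddle (R : realType) (m : nat) : R :=
  hardy_ramanujan R / (2 * Num.sqrt m%:R).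

Lemma saddle_gt0 (R : realType) (m : nat) : (0 < m)%N -> 0 < saddle R m.
Proof.
move=> m0; rewrite divr_gt0 ?hardy_ramanujan_gt0// mulr_gt0// sqrtr_gt0.
by rewrite ltr0n.
Qed.

Lemma saddle_sqr (R : realType) (m : nat) : (0 < m)%N ->
  saddle R m ^+ 2 * m%:R = pi ^+ 2 / 6.
Proof.
move=> m0; have mR : 0 < m%:R :> R by rewrite ltr0n.
rewrite /saddle expr_div_n hardy_ramanujan_sqr exprMn sqr_sqrtr ?ler0n//.
by field; rewrite gt_eqF.
Qed.

(** Induction on [m] with the recursion. By concavity of the square root, the
    [exp (c * sqrt (m - j))] are at most [exp (c * sqrt m - t * j)] with [t]
    the saddle point; the double sum over [j = k * v] is then at most
    [pi^2 / (6 t^2)], which is exactly [m]. *)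
Lemma card_partitions_le (R : realType) (N m : nat) : (m <= N)%N ->
  #|partitions_of N m|%:R <= expR (hardy_ramanujan R * Num.sqrt m%:R).
Proof.
elim/ltn_ind: m => -[_ _|m IHm mN].
  by rewrite card_partitions0 sqrtr0 mulr0 expR0.
set x : R := m.+1%:R; have x0 : 0 < x by rewrite ltr0n.
set c := hardy_ramanujan R; set t := saddle R m.+1.
have t0 : 0 < t by exact: saddle_gt0.
rewrite -(ler_pM2l x0) -natrM partitions_recursion// natr_sum.
set E := expR (c * _).
have E0 : 0 <= E by exact: expR_ge0.
apply: (@le_trans _ _ (\sum_(k < N) (E / t ^+ 2) * (k.+1%:R ^+ 2)^-1)).
  apply: ler_sum => k _; rewrite natr_sum.
  have kt : 0 < k.+1%:R * t by rewrite mulr_gt0.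
  apply: (@le_trans _ _ (\sum_(i < N) E *
      (i.+1%:R * expR (- (k.+1%:R * t)) ^+ i.+1))); last first.
    rewrite -mulr_sumr -mulrA -invfM -exprMn [t * _]mulrC.
    by rewrite ler_wpM2l// sum_arith_geom_le.
  apply: ler_sum => i _; rewrite natrM mulrCA ler_wpM2l//.
  case: ifP => km; last by rewrite mulr_ge0// exprn_ge0// expR_ge0.
  apply: le_trans (IHm _ _ _) _; [by lia|by lia|].
  rewrite -expRM_natl -expRD ler_expR natrB// -/x.
  have jx : (k.+1 * i.+1)%:R <= x by rewrite ler_nat.
  have := sqrt_sub_le x0 jx; rewrite -(ler_pM2l (hardy_ramanujan_gt0 R)) -/c.
  move=> /le_trans; apply.
  rewrite mulrBr lerD2l mulrN lerN2 /t /saddle -/x -/c natrM.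
  rewrite le_eqVlt; apply/orP; left; apply/eqP.
  by field; rewrite gt_eqF// sqrtr_gt0.
rewrite -mulr_sumr.
apply: (@le_trans _ _ (E / t ^+ 2 * (pi ^+ 2 / 6))).
  by rewrite ler_wpM2l ?sum_sqrV_le// divr_ge0// exprn_ge0// ltW.
rewrite -(@saddle_sqr R m.+1)// -/t -/x.
by rewrite mulrA divfK ?gt_eqF ?exprn_gt0// mulrC.
Qed.

(** * The lower bound for the number of integer partitions *)

(** The two factors of the quotient: expanding the square root to second order
    gives [exp (- t y - t y^2 / x)], where
    [exp (- t y^2 / x) >= 1 - t y^2 / x]; the powers give
    [(x / (x - y)) ^+ C], at least [1 + C y / x]. *)
Lemma saddle_ratio (R : realType) (x y c : R) (C : nat)
    (t := c / (2 * Num.sqrt x)) :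
  0 < x -> 0 <= y < x -> 0 < c ->
  expR (c * Num.sqrt x) / x ^+ C *
    (expR (- (t * y)) * ((1 - t * y ^+ 2 / x) * (1 + C%:R * y / x)))
  <= expR (c * Num.sqrt (x - y)) / (x - y) ^+ C.
Proof.
move=> x0 /andP[y0 yx] c0; have xy0 : 0 < x - y by rewrite subr_gt0.
have s0 : 0 < Num.sqrt x by rewrite sqrtr_gt0.
set w := t * y ^+ 2 / x; set z := C%:R * y / x.
have z0 : 0 <= z by rewrite divr_ge0 ?mulr_ge0// ltW.
have hE : expR (c * Num.sqrt x) * expR (- (t * y)) * expR (- w) <=
    expR (c * Num.sqrt (x - y)).
  rewrite -!expRD ler_expR.
  have := @sqrt_sub_ge R x y x0; rewrite y0 (ltW yx) => /(_ isT).
  rewrite -(ler_pM2l c0); apply: le_trans.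
  rewrite le_eqVlt; apply/orP; left; apply/eqP; rewrite /w /t; field.
  by rewrite !gt_eqF.
have hC : (1 + z) / x ^+ C <= ((x - y) ^+ C)^-1.
  rewrite ler_pdivrMr ?exprn_gt0// mulrC ler_pdivlMr ?exprn_gt0//.
  have yx0 : 0 <= y / x by rewrite divr_ge0// ltW.
  apply: (@le_trans _ _ ((1 + y / x) ^+ C * (x - y) ^+ C)).
    have -> : z = C%:R * (y / x) by rewrite /z mulrA.
    by rewrite ler_wpM2r ?bernoulli_ineq// exprn_ge0// ltW.
  rewrite -exprMn; apply: lerXn2r; rewrite ?nnegrE.
  - by rewrite mulr_ge0 ?(ltW xy0)// addr_ge0.
  - exact: ltW.
  have -> : (1 + y / x) * (x - y) = x - y * y / x by field; rewrite gt_eqF.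
  by rewrite gerBl divr_ge0 ?mulr_ge0// ltW.
have hw : 1 - w <= expR (- w) by exact: expR_ge1Dx.
apply: (@le_trans _ _ (expR (c * Num.sqrt x) * expR (- (t * y)) * expR (- w) *
   ((x - y) ^+ C)^-1)); last first.
  by rewrite ler_wpM2r// invr_ge0 exprn_ge0// ltW.
have -> : expR (c * Num.sqrt x) / x ^+ C *
    (expR (- (t * y)) * ((1 - w) * (1 + z))) =
  expR (c * Num.sqrt x) * expR (- (t * y)) * ((1 - w) * ((1 + z) / x ^+ C)).
  by rewrite -!mulrA; congr (_ * _); rewrite mulrCA; congr (_ * _);
     rewrite mulrCA; congr (_ * _); rewrite mulrC.
rewrite -[X in _ <= X]mulrA ler_wpM2l ?mulr_ge0 ?expR_ge0//.
apply: (@le_trans _ _ (expR (- w) * ((1 + z) / x ^+ C))).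
  by rewrite ler_wpM2r// divr_ge0 ?addr_ge0// exprn_ge0// ltW.
by rewrite ler_wpM2l ?expR_ge0.
Qed.

(** A lower bound for the quotient of the values of
    [expR (c * sqrt x) / x ^+ C] at [m - j] and [m], by [saddle_ratio]. It is
    nonpositive for [j >= m] and [m] large, so that sums over [j] need not be
    cut at [m]. *)
Definition saddle_term (R : realType) (C m j : nat) : R :=
  expR (- (saddle R m * j%:R)) *
  ((1 - saddle R m * j%:R ^+ 2 / m%:R) * (1 + C%:R * j%:R / m%:R)).

(** Expand the polynomial in [v] and estimate its four moments. The first one
    is the main term; the second one, multiplied by [C], is the gain. *)
Lemma saddle_term_sum_ge (R : realType) (C m k : nat)
    (t := saddle R m) (x : R := m%:R) : (0 < m)%N ->
  (k.+1%:R ^+ 2)^-1 *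
   ((t ^+ 2)^-1 - (m.+1%:R * expR (- t) ^+ m / t ^+ 2
                   + 96 / (x * t ^+ 3) + C%:R * (768 / (x ^+ 2 * t ^+ 4))))
  - 4^-1
  + C%:R / x * \sum_(v < m) (v.+1%:R ^+ 2 * expR (- (k.+1%:R * t)) ^+ v.+1)
  <= \sum_(v < m) v.+1%:R * saddle_term R C m (k.+1 * v.+1).
Proof.
move=> m0; have t0 : 0 < t by exact: saddle_gt0.
have x0 : 0 < x by rewrite ltr0n.
set K : R := k.+1%:R; have K0 : 0 < K by rewrite ltr0n.
have K1 : 1 <= K by rewrite ler1n.
have [tn xn Kn] : [/\ 0 <= t, 0 <= x & 0 <= K] by split; exact: ltW.
have y0 : 0 < K * t by rewrite mulr_gt0.
set q := expR (- (K * t)).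
have q0 : 0 < q := expR_gt0 _.
have M1 := sum_arith_geom_ge m y0.
have M3 := sum_pow_geom_le 2 m y0.
have M4 := sum_pow_geom_le 3 m y0.
rewrite -/q in M1 M3 M4.
set S1 := \sum_(v < m) _ in M1; set S3 := \sum_(v < m) _ in M3.
set S4 := \sum_(v < m) _ in M4; set S2 := \sum_(v < m) _.
have -> : \sum_(v < m) v.+1%:R * saddle_term R C m (k.+1 * v.+1) =
    S1 + C%:R / x * K * S2 - t / x * K ^+ 2 * S3 - t / x * K ^+ 3 * (C%:R / x) * S4.
  rewrite /S1 /S2 /S3 /S4 !mulr_sumr -!sumrN -!big_split /=.
  apply: eq_bigr => v _; rewrite /saddle_term -/t -/x natrM -/K.
  have -> : - (t * (K * v.+1%:R)) = v.+1%:R * (- (K * t)) by ring.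
  rewrite expRM_natl -/q; field; by rewrite gt_eqF.
clearbody t x K.
have h3 : t / x * K ^+ 2 * S3 <= (K ^+ 2)^-1 * (96 / (x * t ^+ 3)).
  have c0 : 0 <= t / x * K ^+ 2 by rewrite mulr_ge0 ?divr_ge0 ?exprn_ge0.
  apply: le_trans (ler_wpM2l c0 M3) _.
  rewrite le_eqVlt; apply/orP; left; apply/eqP.
  have -> : (3)`!%:R * 2 ^+ 4 = 96 :> R.
    by rewrite -natrX -natrM; congr _%:R; rewrite !factS fact0.
  by field; rewrite !gt_eqF.
have h4 : t / x * K ^+ 3 * (C%:R / x) * S4 <=
    (K ^+ 2)^-1 * (C%:R * (768 / (x ^+ 2 * t ^+ 4))).
  have c0 : 0 <= t / x * K ^+ 3 * (C%:R / x).
    by rewrite !mulr_ge0 ?invr_ge0 ?exprn_ge0.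
  apply: le_trans (ler_wpM2l c0 M4) _.
  rewrite le_eqVlt; apply/orP; left; apply/eqP.
  have -> : (4)`!%:R * 2 ^+ 5 = 768 :> R.
    by rewrite -natrX -natrM; congr _%:R; rewrite !factS fact0.
  by field; rewrite !gt_eqF.
have h2 : C%:R / x * S2 <= C%:R / x * K * S2.
  have S20 : 0 <= S2.
    by apply: sumr_ge0 => v _; rewrite mulr_ge0 ?exprn_ge0// ltW.
  by rewrite -[X in _ <= X]mulrA ler_wpM2l ?divr_ge0// ler_peMl.
have h1 : (K ^+ 2)^-1 * ((t ^+ 2)^-1 - m.+1%:R * expR (- t) ^+ m / t ^+ 2) - 4^-1
    <= S1.
  apply: le_trans M1.
  have -> : ((K * t) ^+ 2)^-1 = (K ^+ 2)^-1 * (t ^+ 2)^-1 by rewrite exprMn invfM.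
  rewrite mulrBr addrAC lerD2l lerN2.
  rewrite [X in _ <= X]mulrC -[X in _ <= X]mulrA [X in _ <= _ * X]mulrC.
  rewrite ler_wpM2r ?mulr_ge0 ?invr_ge0 ?exprn_ge0// ler_wpM2l//.
  apply: lerXn2r; rewrite ?nnegrE ?expR_ge0//.
  by rewrite ler_expR lerN2 ler_peMl.
move: h1 h2 h3 h4; rewrite !mulrBr !mulrDr.
set a1 := (K ^+ 2)^-1 * (t ^+ 2)^-1.
set a2 := (K ^+ 2)^-1 * (m.+1%:R * _ / _).
set a3 := (K ^+ 2)^-1 * (96 / _); set a4 := (K ^+ 2)^-1 * (C%:R * _).
set b2 := C%:R / x * S2; set b3 := _ * S2; set b4 := _ * S3; set b5 := _ * S4.
clearbody a1 a2 a3 a4 b2 b3 b4 b5 S1; lra.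
Qed.

Lemma saddle_mul_sqrt (R : realType) (m : nat) : (0 < m)%N ->
  saddle R m * Num.sqrt m%:R = hardy_ramanujan R / 2.
Proof.
move=> m0; have s0 : 0 < Num.sqrt m%:R :> R by rewrite sqrtr_gt0 ltr0n.
by rewrite /saddle; field; rewrite gt_eqF.
Qed.

(** The terms with [V < v <= 2 V] suffice: [V] is about [1 / t], hence they
    are all of order [s ^+ 2]. *)
Lemma sum_sqr_geom_ge (R : realType) (t c s : R) (m V : nat) :
  0 < t -> 0 <= s / 2 <= V%:R -> V%:R * t <= c / 2 -> (2 * V <= m)%N ->
  s ^+ 3 / 8 * expR (- c) <= \sum_(v < m) v.+1%:R ^+ 2 * expR (- t) ^+ v.+1.
Proof.
move=> t0 /andP[s0 sV] Vt Vm.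
have q0 : 0 < expR (- t) by exact: expR_gt0.
pose F (v : nat) : R := v.+1%:R ^+ 2 * expR (- t) ^+ v.+1.
have F0 v : 0 <= F v by rewrite mulr_ge0 ?exprn_ge0// ltW.
apply: le_trans (ler_sum_ord_widen Vm F0).
rewrite mul2n -addnn big_split_ord /=.
apply: (@le_trans _ _ (\sum_(v < V) V%:R ^+ 2 * expR (- c))); last first.
  rewrite -[X in X <= _]add0r lerD ?sumr_ge0//; apply: ler_sum => v _.
  have vV := ltn_ord v.
  apply: ler_pM; rewrite ?exprn_ge0 ?expR_ge0//.
    by rewrite lerXn2r ?nnegrE// ler_nat; lia.
  rewrite -expRM_natl ler_expR mulrN lerN2.
  have vV2 : (V + v).+1%:R <= 2 * V%:R :> R by rewrite -natrM ler_nat; lia.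
  have := ler_wpM2r (ltW t0) vV2; lra.
rewrite sumr_const card_ord -[X in _ <= X]mulr_natl mulrA -exprS.
rewrite ler_wpM2r ?expR_ge0//.
have -> : s ^+ 3 / 8 = (s / 2) ^+ 3.
  by rewrite expr_div_n; congr (_ / _); rewrite -natrX.
by apply: lerXn2r; rewrite ?nnegrE.
Qed.

(** Summing [saddle_term_sum_ge] over [k < V] with [V] about [sqrt m], the
    main term is [m] up to [O(sqrt m)], by the rate in [sum_sqrV_ge]. The gain
    is [C] times a multiple of [sqrt m]. Since the errors proportional to [C]
    are bounded, a large [C], and then a large [m], make the gain win. *)
Lemma saddle_total_ge (R : realType) : exists C m0 : nat, forall m : nat,
  (m0 <= m)%N -> exists2 V : nat, (V <= m)%N &
  m%:R <= \sum_(k < V) \sum_(v < m)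
            v.+1%:R * saddle_term R C m (k.+1 * v.+1).
Proof.
set c := hardy_ramanujan R.
have c0 : 0 < c by exact: hardy_ramanujan_gt0.
have e0 : 0 < expR (- c) by exact: expR_gt0.
have e1 : 1 <= expR c by rewrite -expR0 ler_expR ltW.
(* [d1] is large enough for the gain to outweigh all the errors of order [sqrt m], and
   [d2] for it to outweigh the error [768 * C]. *)
have [d1 d1E] : exists d : R, d = 16 * 160 by eexists.
have [d3 d3E] : exists d : R, d = 768 by eexists.
have [d2 d2E] : exists d : R, d = 16 * d3 by eexists.
have d10 : 0 <= d1 by lra.
have d30 : 0 <= d3 by rewrite d3E; exact: ler0n.
have d20 : 0 <= d2 by lra.
pose C := (Num.truncn (d1 * expR c)).+1.
have C0 : 0 <= C%:R :> R by [].
have hC : d1 <= C%:R * expR (- c).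
  have /andP[_ /ltW h] := truncn_itv (mulr_ge0 d10 (expR_ge0 c)).
  have := ler_wpM2r (ltW e0) h.
  by rewrite -mulrA expRxMexpNx_1 mulr1.
pose m0 := (Num.truncn ((d2 * expR c) ^+ 2)).+1.
exists C, m0 => m mm0.
set x : R := m%:R; set s := Num.sqrt x.
have mpos : (0 < m)%N by rewrite (leq_trans _ mm0).
have x0 : 0 < x by rewrite ltr0n.
have sx : s ^+ 2 = x by rewrite sqr_sqrtr// ltW.
have sge : d2 * expR c <= s.
  apply: le_sqrt_of_sqr; first by rewrite mulr_ge0// expR_ge0.
  have /andP[_ /ltW h] := truncn_itv (sqr_ge0 (d2 * expR c)).
  by apply: le_trans h _; rewrite ler_nat.
have s1 : d2 <= s by apply: le_trans sge; rewrite ler_peMr.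
have s0 : 0 < s by lra.
have /andP[Vs sV] := truncn_itv (ltW s0); set V := Num.truncn s in Vs sV.
have V2m : (2 * V <= m)%N.
  by rewrite -(ler_nat R) natrM -/x -sx expr2 ler_pM//; lra.
clearbody V C.
exists V; first by apply: leq_trans V2m; rewrite leq_pmull.
rewrite -natr1 in sV.
have VR : s / 2 <= V%:R by lra.
have V0 : 0 < V%:R :> R by lra.
set t := saddle R m; have t0 : 0 < t by exact: saddle_gt0.
have ts : t * s = c / 2 by exact: saddle_mul_sqrt.
have ts1 : 1 <= t * s by rewrite ts; have := hardy_ramanujan_ge2 R; rewrite -/c; lra.
set p : R := pi ^+ 2 / 6; have p1 : 1 <= p by exact: pi_sqr_ge6.
have tp : t ^+ 2 * x = p by exact: saddle_sqr.
apply: (le_trans _ (ler_sum _ _)); last first.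
  by move=> k _; exact: (saddle_term_sum_ge R C k mpos).
rewrite -/t -/x -d3E.
have xE : m%:R = x by [].
have mS : m.+1%:R = x + 1 by rewrite -natr1.
have x1 : 1 <= x by rewrite ler1n.
clearbody t x.
have tn := ltW t0; have xn := ltW x0.
set E := _ + _ + _.
set Z := \sum_(k < V) (k.+1%:R ^+ 2)^-1 : R.
set M := fun k : nat =>
  \sum_(v < m) v.+1%:R ^+ 2 * expR (- (k.+1%:R * t)) ^+ v.+1.
have M0 k : 0 <= M k.
  by apply: sumr_ge0 => v _; rewrite mulr_ge0 ?exprn_ge0// expR_ge0.
have -> : \sum_(k < V) ((k.+1%:R ^+ 2)^-1 * ((t ^+ 2)^-1 - E) - 4^-1
     + C%:R / x * M k) =
  Z * (t ^+ 2)^-1 - Z * E - V%:R / 4 + C%:R / x * \sum_(k < V) M k.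
  rewrite !big_split /= -mulr_suml sumrN sumr_const card_ord -mulr_sumr mulrBr.
  by rewrite [V%:R / 4]mulr_natl.
have Zp : Z <= p by exact: sum_sqrV_le.
have Zge : p - 6 / V%:R <= Z by apply: sum_sqrV_ge; rewrite -(ltr_nat R).
have Z0 : 0 <= Z by apply: sumr_ge0 => k _; rewrite invr_ge0 exprn_ge0.
have b1 : x - 12 * s <= Z * (t ^+ 2)^-1.
  have i0 : 0 <= (t ^+ 2)^-1 by rewrite invr_ge0 exprn_ge0// ltW.
  apply: le_trans (ler_wpM2r i0 Zge); rewrite mulrBl.
  have -> : p * (t ^+ 2)^-1 = x by rewrite -tp mulrAC mulfV ?mul1r// gt_eqF ?exprn_gt0.
  rewrite lerD2l lerN2.
  have i1 : 6 / V%:R <= 12 / s.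
    by rewrite ler_pdivrMr// mulrAC ler_pdivlMr//; lra.
  have i2 : (t ^+ 2)^-1 <= x.
    by rewrite -[X in X <= _]mul1r ler_pdivrMr ?exprn_gt0// mulrC tp.
  apply: (@le_trans _ _ (12 / s * x)).
    by apply: ler_pM => //; rewrite ?divr_ge0 ?invr_ge0 ?exprn_ge0// ltW.
  by rewrite -sx expr2 mulrA divfK ?gt_eqF.
(* The errors: they come from cutting the sum over [v], and from the third and
   fourth moments. *)
have b2 : Z * E <= 48 + 96 * s + d3 * C%:R.
  have E0 : 0 <= E.
    apply: addr_ge0; first apply: addr_ge0.
    - by rewrite divr_ge0 ?mulr_ge0 ?exprn_ge0 ?expR_ge0.
    - by rewrite divr_ge0 ?mulr_ge0 ?exprn_ge0.
    - by rewrite mulr_ge0 ?divr_ge0 ?mulr_ge0 ?exprn_ge0.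
  apply: le_trans (ler_wpM2r E0 Zp) _; rewrite -tp /E.
  have -> : t ^+ 2 * x * (m.+1%:R * expR (- t) ^+ m / t ^+ 2 + 96 / (x * t ^+ 3)
      + C%:R * (d3 / (x ^+ 2 * t ^+ 4))) =
      x * m.+1%:R * expR (- t) ^+ m + 96 / t + C%:R * (d3 / (t ^+ 2 * x)).
    by field; rewrite !gt_eqF.
  apply: lerD; first apply: lerD.
  - rewrite -expRM_natl mulrN xE.
    have xt : s <= x * t by rewrite -sx expr2 -mulrA [s * t]mulrC ler_peMr// ltW.
    apply: (@le_trans _ _ (2 * s ^+ 4 * expR (- s))).
      apply: ler_pM; rewrite ?mulr_ge0 ?expR_ge0 ?(ltW x0)//; last first.
        by rewrite ler_expR lerN2.
      have -> : s ^+ 4 = x ^+ 2 by rewrite -sx -exprM.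
      by rewrite mS expr2 mulrCA ler_wpM2l//; lra.
    have h := expR_ge1Dxn 3 (ltW s0).
    have h4 : s ^+ 4 <= 24 * expR s.
      have -> : 24 = (4)`!%:R :> R by rewrite !factS fact0.
      rewrite -ler_pdivrMl ?ltr0n ?fact_gt0// mulrC; apply: le_trans h.
      by rewrite lerDr.
    have := ler_wpM2r (expR_ge0 (- s)) h4.
    by rewrite -[24 * _ * _]mulrA expRxMexpNx_1; lra.
  - by rewrite ler_pdivrMr// -mulrA [s * t]mulrC ler_peMr.
  - rewrite tp mulrC ler_wpM2r// ler_pdivrMr ?ler_peMr//; lra.
(* The gain, for which the terms with [k = 0] suffice. *)
have b3 : C%:R * expR (- c) * s / 8 <= C%:R / x * \sum_(k < V) M k.
  have Vpos : (0 < V)%N by rewrite -(ltr_nat R).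
  have h : s ^+ 3 / 8 * expR (- c) <= \sum_(k < V) M k.
    apply: (@le_trans _ _ (M 0%N)).
      rewrite /M mul1r; apply: (@sum_sqr_geom_ge _ t c s m V) => //.
        by rewrite VR divr_ge0// ltW.
      by rewrite -ts mulrC ler_wpM2l// ltW.
    rewrite (bigD1 (Ordinal Vpos))//= lerDl; exact: sumr_ge0.
  have cx0 : 0 <= C%:R / x by rewrite divr_ge0// ltW.
  apply: le_trans (ler_wpM2l cx0 h).
  rewrite -sx le_eqVlt; apply/orP; left; apply/eqP; field; rewrite gt_eqF//.
have k1 : 160 * s <= C%:R * expR (- c) * s / 16.
  by have := ler_wpM2r (ltW s0) hC; rewrite d1E; lra.
have k2 : d3 * C%:R <= C%:R * expR (- c) * s / 16.
  have h : d2 <= expR (- c) * s.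
    have := ler_wpM2l (ltW e0) sge.
    by rewrite mulrCA [expR (- c) * expR c]mulrC expRxMexpNx_1 mulr1.
  by have := ler_wpM2l C0 h; rewrite mulrA d2E; lra.
move: b1 b2 b3 k1 k2.
set a1 := Z * _; set a2 := Z * E; set a3 := C%:R / x * _.
set a4 := C%:R * expR (- c) * s; set vv := V%:R in Vs sV *.
clearbody a1 a2 a3 a4 vv; lra.
Qed.

(** Induction on [m]: [saddle_total_ge] says that the recursion reproduces the
    lower bound for [m] large, and [A] is chosen to make it trivial for the
    other [m]. *)
Lemma card_partitions_ge (R : realType) : exists (A : R) (C : nat), 0 < A /\
  forall N m : nat, (0 < m <= N)%N ->
  A * (expR (hardy_ramanujan R * Num.sqrt m%:R) / m%:R ^+ C)
    <= #|partitions_of N m|%:R.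
Proof.
have [C [m0 total]] := saddle_total_ge R.
set c := hardy_ramanujan R.
have c0 : 0 < c by exact: hardy_ramanujan_gt0.
exists (expR (- (c * Num.sqrt m0%:R))), C; split; first exact: expR_gt0.
set A := expR (- _).
have A0 : 0 <= A by exact: expR_ge0.
move=> N; elim/ltn_ind => m IHm /andP[mpos mN].
have mR : 0 < m%:R :> R by rewrite ltr0n.
have [mm0|m0m] := leqP m m0.
  apply: (@le_trans _ _ 1); last by rewrite ler1n card_partitions_gt0.
  rewrite mulrA ler_pdivrMr ?exprn_gt0// mul1r -expRD.
  apply: (@le_trans _ _ 1); last by rewrite exprn_ege1// ler1n.
  rewrite -[X in _ <= X]expR0 ler_expR addrC subr_le0 ler_wpM2l ?(ltW c0)//.
  by apply: ler_wsqrtr; rewrite ler_nat.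
set L := expR (c * _) / _.
have L0 : 0 <= L by rewrite divr_ge0 ?expR_ge0// exprn_ge0// ltW.
have [V Vm tot] := total m (ltnW m0m).
pose F (k i : nat) : nat := (i.+1 *
  if k.+1 * i.+1 <= m then #|partitions_of N (m - k.+1 * i.+1)| else 0)%N.
have term (j : nat) : (0 < j)%N -> A * L * saddle_term R C m j <=
    (if (j <= m)%N then #|partitions_of N (m - j)| else 0%N)%:R.
  move=> j0; have jR : 0 < j%:R :> R by rewrite ltr0n.
  have [jm|mj] := ltnP j m.
    rewrite (ltnW jm).
    have mj0 : (0 < m - j <= N)%N by lia.
    have mjm : (m - j < m)%N by lia.
    apply: le_trans (IHm _ mjm mj0).
    rewrite -mulrA ler_wpM2l// natrB ?(ltnW jm)//.
    apply: saddle_ratio => //.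
    by rewrite ler0n ltr_nat.
  apply: (@le_trans _ _ 0); last by case: ifP.
  have f2 : 0 <= 1 + C%:R * j%:R / m%:R :> R.
    by rewrite addr_ge0// divr_ge0 ?mulr_ge0.
  suff f1 : 1 - saddle R m * j%:R ^+ 2 / m%:R <= 0.
    apply: mulr_ge0_le0; first exact: mulr_ge0.
    by apply: mulr_ge0_le0; [exact: expR_ge0 | exact: mulr_le0_ge0].
  rewrite subr_le0 ler_pdivlMr// mul1r.
  have s1 : 1 <= Num.sqrt m%:R :> R.
    by apply: le_sqrt_of_sqr => //; rewrite expr1n ler1n.
  have ts : 1 <= saddle R m * Num.sqrt m%:R.
    by rewrite saddle_mul_sqrt//; have := hardy_ramanujan_ge2 R; lra.
  have tm : 1 <= saddle R m * m%:R.
    have <- : Num.sqrt m%:R ^+ 2 = m%:R :> R by rewrite sqr_sqrtr.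
    rewrite expr2 mulrA; apply: (le_trans s1); rewrite ler_peMl//.
  have mjR : m%:R <= j%:R :> R by rewrite ler_nat.
  rewrite expr2 mulrA; apply: (le_trans mjR).
  rewrite ler_peMl ?(ltW jR)//; apply: (le_trans tm).
  by rewrite ler_wpM2l// ltW// saddle_gt0.
rewrite -(ler_pM2l mR) -[X in _ <= X]natrM partitions_recursion// natr_sum.
have F0 k i : 0 <= (F k i)%:R :> R by [].
apply: (@le_trans _ _ (\sum_(k < V) \sum_(i < m) (F k i)%:R)); last first.
  apply: (@le_trans _ _ (\sum_(k < V) (\sum_(i < N) F k i)%N%:R)).
    apply: ler_sum => k _; rewrite natr_sum.
    exact: (@ler_sum_ord_widen R m N (fun i => (F k i)%:R)).
  apply: (@ler_sum_ord_widen R V N (fun k => (\sum_(i < N) F k i)%N%:R)) => //.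
  exact: leq_trans mN.
apply: (@le_trans _ _ (A * L * \sum_(k < V) \sum_(v < m)
            v.+1%:R * saddle_term R C m (k.+1 * v.+1))).
  by rewrite mulrC ler_wpM2l// mulr_ge0.
rewrite mulr_sumr; apply: ler_sum => k _.
rewrite mulr_sumr; apply: ler_sum => v _.
rewrite mulrCA /F natrM ler_wpM2l//; exact: term.
Qed.

(** * Tilings *)

(** The interior of a rectangle in coordinates, see [interior_rect_set] and
    [open_rect_interior]. *)
Definition open_rect (R : realType) (r : rectangle R) (p : R * R) : Prop :=
  (corner r).1 < p.1 < (corner r).1 + (width r)%:R /\
  (corner r).2 < p.2 < (corner r).2 + (height r)%:R.

Definition in_box (R : realType) (x y : R) (w h : nat) (p : R * R) : Prop :=
  x <= p.1 <= x + w%:R /\ y <= p.2 <= y + h%:R.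

Lemma rect_setE (R : realType) (r : rectangle R) (p : R * R) :
  rect_set r p <-> in_box (corner r).1 (corner r).2 (width r) (height r) p.
Proof. by rewrite /rect_set /in_box /= !in_itv. Qed.

Lemma interior_rect_set (R : realType) (r : rectangle R) (p : R * R) :
  (rect_set r)° p -> open_rect r p.
Proof.
move=> /nbhs_ballP[e /= e0 pe].
have e20 : 0 < e / 2 by rewrite divr_gt0.
have inb (d : R) : `|d| < e -> rect_set r (p.1 + d, p.2 + d).
  move=> de; apply: pe; split; rewrite /ball/= opprD addrA subrr sub0r normrN//.
have /inb/rect_setE[/= a1 a2] : `|e / 2| < e by rewrite gtr0_norm//; lra.
have /inb/rect_setE[/= b1 b2] : `|- (e / 2)| < e by rewrite normrN gtr0_norm//; lra.
move: a1 a2 b1 b2 => /andP[? ?] /andP[? ?] /andP[? ?] /andP[? ?].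
split; apply/andP; split; lra.
Qed.

Lemma open_rect_interior (R : realType) (r : rectangle R) (p : R * R) :
  open_rect r p -> (rect_set r)° p.
Proof.
move=> [/andP[a b] /andP[c d]].
pose e := Num.min (Num.min (p.1 - (corner r).1) ((corner r).1 + (width r)%:R - p.1))
  (Num.min (p.2 - (corner r).2) ((corner r).2 + (height r)%:R - p.2)).
apply/nbhs_ballP; exists e => /=; first by rewrite !lt_min !subr_gt0 a b c.
move=> q [/=]; rewrite /ball/= !lt_min => /andP[/andP[+ +] _] /andP[_ /andP[+ +]].
rewrite !ltr_norml => /andP[? ?] /andP[? ?] /andP[? ?] /andP[? ?].
by apply/rect_setE; split; apply/andP; split; lra.
Qed.

Definition rect0 (R : realType) : rectangle R := Rectangle (0, 0) 0 0.

(** Tilings by a list of rectangles of a box in any position: unlike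
    [is_tiling], this can be glued. *)
Definition tiles (R : realType) (s : seq (rectangle R)) (x y : R) (w h : nat) :=
  [/\ forall i, (i < size s)%N ->
        (0 < width (nth (rect0 R) s i))%N /\ (0 < height (nth (rect0 R) s i))%N,
      forall p, (exists2 i, (i < size s)%N & rect_set (nth (rect0 R) s i) p) <->
        in_box x y w h p
    & forall i j p, (i < size s)%N -> (j < size s)%N ->
        open_rect (nth (rect0 R) s i) p -> open_rect (nth (rect0 R) s j) p -> i = j].

Definition in_open_box (R : realType) (x y : R) (w h : nat) (p : R * R) : Prop :=
  x < p.1 < x + w%:R /\ y < p.2 < y + h%:R.

Lemma tiles_open (R : realType) (s : seq (rectangle R)) (x y : R) (w h i : nat)
    (p : R * R) :
  tiles s x y w h -> (i < size s)%N -> open_rect (nth (rect0 R) s i) p ->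
  in_open_box x y w h p.
Proof.
move=> [_ cover _] iS; set r := nth _ _ _ => -[/andP[? ?] /andP[? ?]].
have [|/andP[? _] /andP[? _]] := (cover (corner r)).1.
  by exists i => //; apply/rect_setE; rewrite /in_box !lexx !lerDl !ler0n.
have [|/andP[_ /= ?] /andP[_ /= ?]] :=
    (cover ((corner r).1 + (width r)%:R, (corner r).2 + (height r)%:R)).1.
  by exists i => //; apply/rect_setE; rewrite /in_box /= !lexx !lerDl !ler0n.
by split; apply/andP; split; lra.
Qed.

Lemma tiles_cat (R : realType) (s1 s2 : seq (rectangle R))
    (x1 y1 x2 y2 x y : R) (w1 h1 w2 h2 w h : nat) :
  tiles s1 x1 y1 w1 h1 -> tiles s2 x2 y2 w2 h2 ->
  (forall p, in_box x1 y1 w1 h1 p \/ in_box x2 y2 w2 h2 p <-> in_box x y w h p) ->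
  (forall p, in_open_box x1 y1 w1 h1 p -> in_open_box x2 y2 w2 h2 p -> False) ->
  tiles (s1 ++ s2) x y w h.
Proof.
move=> t1 t2 cover disj; split.
- move=> i; rewrite size_cat nth_cat => iS; have [pos1 _ _] := t1.
  have [pos2 _ _] := t2; case: (ltnP i (size s1)) => i1; first exact: pos1.
  by apply: pos2; rewrite ltn_subLR.
- have [_ c1 _] := t1; have [_ c2 _] := t2 => p; split.
    move=> [i]; rewrite size_cat nth_cat => iS; case: (ltnP i (size s1)) => i1 ip;
      apply/cover.
      by left; apply/c1; exists i.
    by right; apply/c2; exists (i - size s1)%N; rewrite ?ltn_subLR.
  move=> /cover[/c1|/c2] [i iS ip].
    exists i; first by rewrite size_cat ltn_addr.
    by rewrite nth_cat iS.
  exists (size s1 + i)%N; first by rewrite size_cat ltn_add2l.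
  by rewrite nth_cat ltnNge leq_addr/= addKn.
- have [_ _ d1] := t1; have [_ _ d2] := t2 => i j p.
  rewrite size_cat !nth_cat; case: (ltnP i (size s1)) => i1;
    case: (ltnP j (size s1)) => j1 iS jS pi pj.
  + exact: d1 _ _ _ i1 j1 pi pj.
  + have j2 : (j - size s1 < size s2)%N by rewrite ltn_subLR.
    by case: (disj p (tiles_open t1 i1 pi) (tiles_open t2 j2 pj)).
  + have i2 : (i - size s1 < size s2)%N by rewrite ltn_subLR.
    by case: (disj p (tiles_open t1 j1 pj) (tiles_open t2 i2 pi)).
  + have : (i - size s1 = j - size s1)%N.
      by apply: (d2 _ _ _ _ _ pi pj); rewrite ltn_subLR.
    by lia.
Qed.

Definition rect_size (R : realType) (r : rectangle R) : nat * nat :=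
  (width r, height r).

(** The box may be placed anywhere, so that adjacent boxes can be tiled
    separately. *)
Definition tileable (R : realType) (s : seq (nat * nat)) (w h : nat) : Prop :=
  forall x y : R, exists2 T : seq (rectangle R),
    tiles T x y w h & [seq rect_size r | r <- T] = s.

Lemma tileable1 (R : realType) (w h : nat) : (0 < w)%N -> (0 < h)%N ->
  tileable R [:: (w, h)] w h.
Proof.
move=> w0 h0 x y; exists [:: Rectangle (x, y) w h] => //; split => /=.
- by case.
- move=> p; split; first by move=> [[|//] _ /rect_setE].
  by move=> xp; exists 0%N => //; apply/rect_setE.
- by case=> [|//] [|//].
Qed.

Lemma tileable_beside (R : realType) (s1 s2 : seq (nat * nat)) (w1 w2 h : nat) :
  tileable R s1 w1 h -> tileable R s2 w2 h -> tileable R (s1 ++ s2) (w1 + w2) h.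
Proof.
move=> t1 t2 x y; have [T1 tT1 <-] := t1 x y; have [T2 tT2 <-] := t2 (x + w1%:R) y.
exists (T1 ++ T2); last by rewrite map_cat.
have w10 : 0 <= w1%:R :> R by []; have w20 : 0 <= w2%:R :> R by [].
apply: (tiles_cat tT1 tT2) => p; rewrite /in_box /in_open_box.
  rewrite natrD; split.
    by case=> -[/andP[? ?] ->]; split => //; apply/andP; split; lra.
  move=> [/andP[? ?] ->]; have [?|?] := leP p.1 (x + w1%:R); [left|right].
    by split => //; apply/andP; split; lra.
  by split => //; apply/andP; split; lra.
by move=> [/andP[_ ?] _] [/andP[? _] _]; lra.
Qed.

Lemma tileable_above (R : realType) (s1 s2 : seq (nat * nat)) (w h1 h2 : nat) :
  tileable R s1 w h1 -> tileable R s2 w h2 -> tileable R (s1 ++ s2) w (h1 + h2).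
Proof.
move=> t1 t2 x y; have [T1 tT1 <-] := t1 x y; have [T2 tT2 <-] := t2 x (y + h1%:R).
exists (T1 ++ T2); last by rewrite map_cat.
have h10 : 0 <= h1%:R :> R by []; have h20 : 0 <= h2%:R :> R by [].
apply: (tiles_cat tT1 tT2) => p; rewrite /in_box /in_open_box.
  rewrite natrD; split.
    by case=> -[-> /andP[? ?]]; split => //; apply/andP; split; lra.
  move=> [-> /andP[? ?]]; have [?|?] := leP p.2 (y + h1%:R); [left|right].
    by split => //; apply/andP; split; lra.
  by split => //; apply/andP; split; lra.
by move=> [_ /andP[_ ?]] [_ /andP[? _]]; lra.
Qed.

Lemma tileable_column (R : realType) (w : nat) (l : seq nat) : (0 < w)%N ->
  (0 < sumn l)%N -> all (leq 1) l -> tileable R [seq (w, k) | k <- l] w (sumn l).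
Proof.
move=> w0; elim: l => // k l IHl _ /= /andP[k0 l0].
have [sl|] := posnP (sumn l); last first.
  by move=> sl; apply: (@tileable_above R [:: (w, k)]); [exact: tileable1 | exact: IHl].
have -> : l = [::] by case: l l0 sl {IHl} => // j l /= /andP[j0 _]; lia.
by rewrite /= addn0; exact: tileable1.
Qed.

Lemma tileable_partition (R : realType) (s : seq (nat * nat)) (m n : nat) :
  tileable R s m n ->
  rect_partitions R m n
    (seq_mset [seq (minn a.1 a.2, maxn a.1 a.2) | a <- s]).
Proof.
move=> /(_ 0 0)[T [pos cover disj] <-].
exists (size T), (fun i => nth (rect0 R) T i); split.
  split.
  - by move=> i; exact: pos.
  - apply/seteqP; split => [p [i _ ip]|p].
      have /cover[] : exists2 i, (i < size T)%N & rect_set (nth (rect0 R) T i) p.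
        by exists i.
      by rewrite !add0r => p1 p2; split; rewrite /= in_itv.
    move=> [/= p1 p2].
    have [|i iT ip] := (cover p).2.
      by split; rewrite add0r; [move: p1|move: p2]; rewrite in_itv.
    by exists (Ordinal iT).
  - move=> i j _ _ [p [/interior_rect_set pi /interior_rect_set pj]].
    exact/val_inj/(disj _ _ _ (ltn_ord i) (ltn_ord j) pi pj).
congr seq_mset; apply: (@eq_from_nth _ (0, 0)%N) => [|i].
  by rewrite !size_map -enumT size_enum_ord.
rewrite !size_map => iT; rewrite (nth_map (0, 0)%N) ?size_map//.
rewrite (nth_map (rect0 R))// (nth_map (Ordinal iT)) -?enumT ?size_enum_ord//.
by rewrite nth_enum_ord.
Qed.

(** The interiors of the tiles are disjoint, contained in the large rectangle,
    and their Lebesgue measures are the areas. *)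
Lemma tiling_area_le (R : realType) (m n k : nat) (T : 'I_k -> rectangle R) :
  is_tiling m n T -> (\sum_(i < k) width (T i) * height (T i) <= m * n)%N.
Proof.
move=> [_ cover disj].
pose mu := ((@lebesgue_measure R) \x (@lebesgue_measure R))%E.
pose O (i : 'I_k) : set (measurableTypeR R * measurableTypeR R) :=
  `](corner (T i)).1, (corner (T i)).1 + (width (T i))%:R[ `*`
  `](corner (T i)).2, (corner (T i)).2 + (height (T i))%:R[.
have Oint i : O i `<=` (rect_set (T i))°.
  by move=> p [/= p1 p2]; apply: open_rect_interior; split;
    [move: p1|move: p2]; rewrite in_itv.
have mO i : measurable (O i) by exact: measurableX.
have muO i : mu (O i) = ((width (T i) * height (T i))%N%:R)%:E.
  rewrite /mu product_measure1E//= !lebesgue_measure_itv /= !lte_fin !ltrDl.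
  rewrite -!EFinD.
  have side (a : R) (w : nat) :
      (if 0 < w%:R :> R then (a + w%:R - a)%:E else 0%E) = (w%:R)%:E.
    rewrite addrAC subrr add0r; case: ltP => // w0.
    by have -> : w%:R = 0 :> R by apply/eqP; rewrite eq_le w0 ler0n.
  by rewrite !side -EFinM natrM.
have triv : trivIset [set: 'I_k] O.
  by move=> i j _ _ [p [pi pj]]; apply: (disj i j) => //; exists p; split; exact: Oint.
have mU : measurable (\big[setU/set0]_(i < k) O i) by exact: bigsetU_measurable.
pose B : set (measurableTypeR R * measurableTypeR R) :=
  `[0, m%:R] `*` `[0, n%:R].
have mB : measurable B by exact: measurableX.
have muB : mu B = ((m * n)%N%:R)%:E.
  rewrite /mu product_measure1E//= !lebesgue_measure_itv /= !lte_fin.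
  rewrite !oppr0 !adde0.
  have side (w : nat) :
      (if 0 < w%:R :> R then (w%:R)%:E else 0%E) = (w%:R)%:E :> \bar R.
    case: ltP => // w0.
    by have -> : w%:R = 0 :> R by apply/eqP; rewrite eq_le w0 ler0n.
  by rewrite !side -EFinM natrM.
have sub : \big[setU/set0]_(i < k) O i `<=` B.
  apply: (big_ind (fun A => A `<=` B)) => [|A1 A2 s1 s2|i _]; 
    [exact: sub0set|by rewrite subUset|].
  move=> p /Oint/interior_subset ip.
  have : (\bigcup_j rect_set (T j)) p by exists i.
  by rewrite cover.
have : (mu (\big[setU/set0]_(i < k) O i) <= mu B)%E.
  by apply: le_measure => //; rewrite inE.
have -> : mu (\big[setU/set0]_(i < k) O i) = (\sum_(i < k) mu (O i))%E.
  exact: (measure_semi_additive_ord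
    ((@lebesgue_measure R) \x (@lebesgue_measure R))%E mO triv mU).
rewrite muB.
under eq_bigr do rewrite muO.
by rewrite sumEFin lee_fin -natr_sum ler_nat.
Qed.

(** * From tilings to triples of integer partitions *)

Definition parts (N : nat) (f : multiplicities N) : seq nat :=
  flatten [seq nseq (f i) i.+1 | i <- enum 'I_N].

Lemma big_parts (N : nat) (f : multiplicities N) (F : nat -> nat) :
  (\sum_(k <- parts f) F k = \sum_(i < N) F i.+1 * f i)%N.
Proof.
rewrite /parts big_flatten /= big_map big_enum /=; apply: eq_bigr => i _.
by rewrite big_nseq iter_addn addn0.
Qed.

Lemma count_parts (N : nat) (f : multiplicities N) (P : pred nat) :
  count P (parts f) = (\sum_(i < N) P i.+1 * f i)%N.
Proof.
by rewrite -sum1_count big_mkcond -(big_parts f (fun k => nat_of_bool (P k)));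
  apply: eq_bigr => k _; case: (P k).
Qed.

Lemma count_mem_parts (N : nat) (f : multiplicities N) (i : 'I_N) :
  count_mem i.+1 (parts f) = f i.
Proof.
rewrite count_parts (bigD1 i)//= eqxx mul1n big1 ?addn0// => j ji.
by rewrite eqSS val_eqE (negbTE ji).
Qed.

Lemma count_mem_parts_out (N v : nat) (f : multiplicities N) :
  ~~ (0 < v <= N)%N -> count_mem v (parts f) = 0%N.
Proof.
move=> vN; rewrite count_parts big1// => i _ /=; case: eqP => // iv.
by move: vN; rewrite -iv ltn_ord.
Qed.

Lemma sumn_parts (N : nat) (f : multiplicities N) :
  sumn (parts f) = weight f.
Proof. by rewrite sumnE big_parts. Qed.

Lemma parts_gt0 (N : nat) (f : multiplicities N) : all (leq 1) (parts f).
Proof.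
by apply/allP => k /flattenP[s /mapP[i _ ->]] /nseqP[->].
Qed.

Definition strips (N u : nat) (f : multiplicities N) : seq (nat * nat) :=
  [seq (u, k) | k <- parts f].

Lemma count_mem_strips (N u u' v : nat) (f : multiplicities N) :
  count_mem (u', v) (strips u f) = ((u == u') * count_mem v (parts f))%N.
Proof.
rewrite /strips count_map; have [->|uu'] := eqVneq u u'.
  by rewrite mul1n; apply: eq_count => k /=; rewrite xpair_eqE eqxx.
rewrite mul0n; apply/eqP; rewrite -leqn0 leqNgt -has_count -all_predC.
by apply/allP => k _ /=; rewrite xpair_eqE (negbTE uu').
Qed.

(** Three partitions seen as a list of tiles, of width 1, 2 and 3
    respectively. *)
Definition assemble (N : nat)
    (t : multiplicities N * multiplicities N * multiplicities N) :
    seq (nat * nat) :=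
  strips 1 t.1.1 ++ strips 2 t.1.2 ++ strips 3 t.2.

Lemma sum_area_assemble (N : nat)
    (t : multiplicities N * multiplicities N * multiplicities N) :
  (\sum_(a <- assemble t) a.1 * a.2 =
   weight t.1.1 + 2 * weight t.1.2 + 3 * weight t.2)%N.
Proof.
rewrite /assemble !big_cat /= /strips !big_map /= addnA -!big_distrr /=.
by rewrite !(big_parts _ id) mul1n.
Qed.

(** Take as multiplicities the numbers of occurrences in [s]. The bound on the
    area makes them, and the lengths that occur, at most [N]. *)
Lemma perm_eq_assemble (N : nat) (s : seq (nat * nat)) :
  all (fun a => (0 < a.1 <= 3) && (0 < a.2))%N s ->
  (\sum_(a <- s) a.1 * a.2 <= N)%N ->
  exists t, perm_eq s (@assemble N t).
Proof.
move=> sall sN.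
have area_le (a : nat * nat) : (a.1 * a.2 * count_mem a s <= N)%N.
  apply: leq_trans sN; rewrite -sum1_count big_distrr /= big_mkcond /=.
  by apply: leq_sum => b _; case: eqP => // ->; rewrite muln1.
have small (u v : nat) : (0 < u)%N -> (0 < v)%N -> (count_mem (u, v) s <= N)%N.
  move=> u0 v0; apply: leq_trans (area_le (u, v)) => /=.
  by rewrite leq_pmull// muln_gt0 u0.
pose f (u : nat) : multiplicities N :=
  [ffun i : 'I_N => inord (count_mem (u, i.+1) s)].
exists (f 1%N, f 2%N, f 3%N); rewrite /assemble/=.
have fE u v : (0 < u <= 3)%N -> count_mem v (parts (f u)) = count_mem (u, v) s.
  move=> /andP[u0 u3]; have [/andP[v0 vN]|vN] := boolP (0 < v <= N)%N.
    case: v v0 vN => // v _ vN; rewrite (count_mem_parts _ (Ordinal vN)) ffunE.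
    by rewrite inordK// ltnS small.
  rewrite count_mem_parts_out//; apply/esym/count_memPn; apply: contra vN => sv.
  have /allP/(_ _ sv)/= := sall; rewrite u0 u3 /= => v0; rewrite v0/=.
  apply: leq_trans (area_le (u, v)) => /=.
  have c0 : (0 < count_mem (u, v) s)%N by rewrite -has_count has_pred1.
  by rewrite mulnAC leq_pmull// muln_gt0 u0.
rewrite /perm_eq; apply/allP => -[u v] _ /=; apply/eqP.
rewrite !count_cat !count_mem_strips; have [u13|u13] := boolP (0 < u <= 3)%N.
  rewrite !fE//.
  by case: u u13 => [|[|[|[|u]]]] //= _; rewrite ?mul0n ?mul1n ?addn0.
have -> : count_mem (u, v) s = 0%N.
  apply/count_memPn; apply: contra u13 => sv.
  by have /allP/(_ _ sv)/= /andP[] := sall.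
by case: u u13 => [|[|[|[|u]]]] //= _; rewrite !mul0n.
Qed.

Lemma rect_partition_assemble (R : realType) (n : nat) M :
  rect_partitions R 3 n M ->
  exists t, M = seq_mset (@assemble (3 * n) t) /\
    (weight t.1.1 + 2 * weight t.1.2 + 3 * weight t.2 <= 3 * n)%N.
Proof.
move=> [k [T [tilT ->]]]; have area := tiling_area_le tilT.
have [pos cover _] := tilT.
have area' : (\sum_(a <- [seq rect_type (T i) | i : 'I_k]) a.1 * a.2 <= 3 * n)%N.
  rewrite big_map big_enum /=; apply: leq_trans area; apply: leq_sum => i _.
  by rewrite /rect_type /= minnE maxnE; nia.
have [|t pt] := @perm_eq_assemble (3 * n) _ _ area'.
  apply/allP => a /mapP[i _ ->]; have [w0 h0] := pos i.
  have sub : rect_set (T i) `<=` `[0, 3%:R] `*` `[0, n%:R].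
    by move=> p ip; rewrite -cover; exists i.
  have /sub[/= + _] : rect_set (T i) (corner (T i)).
    by apply/rect_setE; rewrite /in_box !lexx !lerDl !ler0n.
  rewrite in_itv/= => /andP[x0 _].
  have /sub[/= + _] : rect_set (T i) ((corner (T i)).1 + (width (T i))%:R,
      (corner (T i)).2 + (height (T i))%:R).
    by apply/rect_setE; rewrite /in_box /= !lexx !lerDl !ler0n.
  rewrite in_itv/= => /andP[_ x3].
  have w3 : (width (T i) <= 3)%N by rewrite -(ler_nat R); lra.
  by rewrite /rect_type /= leq_min leq_max geq_min w0 h0 w3.
exists t; split; first exact/eq_seq_msetP.
by rewrite -sum_area_assemble -(perm_big _ pt).
Qed.

Definition bounded_triples (N m : nat) :
    {set multiplicities N * multiplicities N * multiplicities N} :=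
  [set t | (weight t.1.1 + 2 * weight t.1.2 + 3 * weight t.2 <= m)%N]%SET.

Lemma num_partitions_le_card (R : realType) (n : nat) :
  finite_set (rect_partitions R 3 n) /\
  (num_partitions R 3 n <= #|bounded_triples (3 * n) (3 * n)|)%N.
Proof.
pose X := [fset seq_mset (assemble t) | t in bounded_triples (3 * n) (3 * n)]%fset.
have sub : rect_partitions R 3 n `<=` [set` X].
  move=> M /rect_partition_assemble[t [-> tN]].
  by apply/imfsetP; exists t; rewrite //= inE.
have fin : finite_set (rect_partitions R 3 n) by exact: sub_finite_set (finite_fset X).
split=> //; rewrite /num_partitions.
apply: (@leq_trans #|` X|).
  apply: fsubset_leq_card; rewrite -(set_fsetK X) -fset_set_sub//.
by rewrite (leq_trans (leq_imfset_card _ _ _))// cardE.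
Qed.

(** Sort the triples by their weights: there are at most [N.+1 ^ 3] possible
    weights. *)
Lemma card_triples_le (R : realType) (N : nat) (E : R) :
  (forall a b c : nat, (a + 2 * b + 3 * c <= N)%N ->
    (#|partitions_of N a| * #|partitions_of N b| * #|partitions_of N c|)%N%:R <= E) ->
  #|bounded_triples N N|%:R <= N.+1%:R ^+ 3 * E.
Proof.
move=> PE.
pose key (t : multiplicities N * multiplicities N *
              multiplicities N) : 'I_N.+1 * 'I_N.+1 * 'I_N.+1 :=
  (inord (weight t.1.1), inord (weight t.1.2), inord (weight t.2)).
rewrite -sum1_card (partition_big key xpredT)//= natr_sum.
have E0 : 0 <= E by exact: le_trans (PE 0%N 0%N 0%N _).
apply: (@le_trans _ _ (\sum_(d : 'I_N.+1 * 'I_N.+1 * 'I_N.+1) E)); last first.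
  rewrite sumr_const !card_prod card_ord -[X in X <= _]mulr_natl !natrM.
  by rewrite !exprS expr0 mulr1 mulrA.
apply: ler_sum => -[[a b] c] _ /=.
have [abc|abc] := leqP (a + 2 * b + 3 * c) N.
  apply: le_trans (PE _ _ _ abc); rewrite ler_nat sum1_card -!cardsX.
  apply/subset_leq_card/fintype.subsetP => -[[f g] h].
  rewrite !inE /= => /andP[+ /eqP[]]; rewrite /bounded_triples inE /= => fghN.
  by move=> /(congr1 val)/= <- /(congr1 val)/= <- /(congr1 val)/= <-;
    rewrite !inordK ?eqxx; lia.
rewrite big_pred0 // => -[[f g] h].
apply/negbTE/negP => /andP[+ /eqP[]]; rewrite /bounded_triples inE /= => fghN.
move=> /(congr1 val)/= fa /(congr1 val)/= gb /(congr1 val)/= hc.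
by move: fa gb hc abc; rewrite !inordK; lia.
Qed.

(** Cauchy-Schwarz inequality, with [1 + 1 / 2 + 1 / 3 = 11 / 6]. *)
Lemma sum_sqrt_le (R : realType) (a b c x : R) :
  0 <= a -> 0 <= b -> 0 <= c -> a + 2 * b + 3 * c <= x ->
  Num.sqrt a + Num.sqrt b + Num.sqrt c <= Num.sqrt (11 / 6 * x).
Proof.
move=> a0 b0 c0 abcx.
apply: le_sqrt_of_sqr; first by rewrite !addr_ge0 ?sqrtr_ge0.
have := sqr_sqrtr a0; have := sqr_sqrtr b0; have := sqr_sqrtr c0.
set u := Num.sqrt a; set v := Num.sqrt b; set w := Num.sqrt c => wE vE uE.
rewrite -wE -vE -uE in abcx.
have := sqr_ge0 (u - 2 * v); have := sqr_ge0 (u - 3 * w).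
have := sqr_ge0 (2 * v - 3 * w); clear wE vE uE; clearbody u v w; nra.
Qed.

Lemma num_partitions_le (R : realType) (n : nat) :
  (num_partitions R 3 n)%:R <=
  (3 * n).+1%:R ^+ 3 * expR (pi * Num.sqrt (11%:R * n%:R / 3%:R)) :> R.
Proof.
have [_ le] := num_partitions_le_card R n.
move: le; rewrite -(ler_nat R) => /le_trans; apply.
apply: card_triples_le => a b c abc.
have [aN [bN cN]] : (a <= 3 * n /\ b <= 3 * n /\ c <= 3 * n)%N by lia.
apply: (@le_trans _ _ (expR (hardy_ramanujan R *
    (Num.sqrt a%:R + Num.sqrt b%:R + Num.sqrt c%:R)))).
  rewrite !mulrDr !expRD !natrM.
  by apply: ler_pM; rewrite ?mulr_ge0//; [apply: ler_pM|]; rewrite ?card_partitions_le.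
rewrite ler_expR /hardy_ramanujan -mulrA ler_wpM2l ?pi_ge0//.
have abcR : a%:R + 2 * b%:R + 3 * c%:R <= 3 * n%:R :> R.
  by rewrite -!natrM -!natrD ler_nat.
have := sum_sqrt_le (ler0n R a) (ler0n R b) (ler0n R c) abcR.
move=> /(ler_wpM2l (sqrtr_ge0 (2 / 3))) /le_trans; apply.
rewrite -sqrtrM ?divr_ge0//; apply: ler_wsqrtr.
by rewrite le_eqVlt; apply/orP; left; apply/eqP; field.
Qed.

(** * From triples of integer partitions to tilings *)

(** Greedily: as long as parts of size at most [K] are left, the three
    remaining lengths add up to at least [3 * K], so that the next part fits
    into one of them. The ones fill up what remains. *)
Lemma split_in_three (K o A B C : nat) (l : seq nat) :
  all (fun k => k <= K)%N l -> (3 * K <= o)%N -> (sumn l + o = A + B + C)%N ->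
  exists l1 l2 l3 : seq nat, [/\ perm_eq (l1 ++ l2 ++ l3) (l ++ nseq o 1%N),
    sumn l1 = A, sumn l2 = B & sumn l3 = C].
Proof.
elim: l A B C => [|x l IHl] A B C /=.
  move=> _ _; rewrite add0n => ->.
  exists (nseq A 1%N), (nseq B 1%N), (nseq C 1%N).
  by rewrite !sumn_nseq !mul1n !nseqD -catA perm_refl.
move=> /andP[xK lK] Ko sl.
have [xA|xA] := leqP x A.
  have [|l1 [l2 [l3 [p s1 s2 s3]]]] := IHl (A - x)%N B C lK Ko; first by lia.
  exists (x :: l1), l2, l3; split=> //=; last by lia.
  by rewrite perm_cons.
have [xB|xB] := leqP x B.
  have [|l1 [l2 [l3 [p s1 s2 s3]]]] := IHl A (B - x)%N C lK Ko; first by lia.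
  exists l1, (x :: l2), l3; split=> //=; last by lia.
  apply/permP => P; move/permP/(_ P): p; rewrite /= !count_cat /= ?count_cat; lia.
have xC : (x <= C)%N by lia.
have [|l1 [l2 [l3 [p s1 s2 s3]]]] := IHl A B (C - x)%N lK Ko; first by lia.
exists l1, l2, (x :: l3); split=> //=; last by lia.
apply/permP => P; move/permP/(_ P): p; rewrite /= !count_cat /= ?count_cat; lia.
Qed.

(** The tiles of width 1, 2 and 3 given by [t], together with [o] unit
    squares. *)
Definition with_units (N o : nat)
    (t : multiplicities N * multiplicities N * multiplicities N) : seq (nat * nat) :=
  [seq (1%N, k) | k <- parts t.1.1 ++ nseq o 1%N] ++ strips 2 t.1.2 ++ strips 3 t.2.

(** The tiles of width 3 are stacked in [[0, 3] x [0, c]], those of width 2 in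
    [[0, 2] x [c, c + b]]; the rest is formed by three columns of width 1, of
    lengths [n - b - c], [n - b - c] and [n - c]. *)
Lemma tileable_with_units (R : realType) (N n K b c : nat)
    (t : multiplicities N * multiplicities N * multiplicities N) :
  all (fun k => k <= K)%N (parts t.1.1) ->
  weight t.1.2 = b -> weight t.2 = c -> (0 < b)%N -> (0 < c)%N -> (b + c < n)%N ->
  (weight t.1.1 + 3 * K + 2 * b + 3 * c = 3 * n)%N ->
  exists2 s, perm_eq s (with_units (3 * K) t) & tileable R s 3 n.
Proof.
case: t => -[f g] h /= fK wg wh b0 c0 bcn wn.
have [|l1 [l2 [l3 [p s1 s2 s3]]]] :=
  @split_in_three K (3 * K) (n - b - c) (n - b - c) (n - c) _ fK (leqnn _).
  by rewrite sumn_parts; lia.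
have pos : all (leq 1) (l1 ++ l2 ++ l3).
  rewrite (perm_all _ p) all_cat parts_gt0 /=.
  by apply/allP => k /nseqP[->].
move: pos; rewrite !all_cat => /and3P[p1 p2 p3].
have t1 : tileable R [seq (1%N, k) | k <- l1] 1 (n - b - c).
  by rewrite -s1; apply: tileable_column => //; lia.
have t2 : tileable R [seq (1%N, k) | k <- l2] 1 (n - b - c).
  by rewrite -s2; apply: tileable_column => //; lia.
have t3 : tileable R [seq (1%N, k) | k <- l3] 1 (n - c).
  by rewrite -s3; apply: tileable_column => //; lia.
have tg : tileable R (strips 2 g) 2 b.
  by rewrite -wg -sumn_parts; apply: tileable_column; rewrite ?sumn_parts ?wg ?parts_gt0.
have th : tileable R (strips 3 h) 3 c.
  by rewrite -wh -sumn_parts; apply: tileable_column; rewrite ?sumn_parts ?wh ?parts_gt0.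
have t12 := tileable_above tg (tileable_beside t1 t2).
have bn : (b + (n - b - c) = n - c)%N by lia.
rewrite bn in t12.
have tall := tileable_above th (tileable_beside t12 t3).
have cn : (c + (n - c) = n)%N by lia.
rewrite cn in tall; exists (strips 3 h ++
  ((strips 2 g ++ [seq (1%N, k) | k <- l1] ++ [seq (1%N, k) | k <- l2]) ++
   [seq (1%N, k) | k <- l3])) => //.
apply/permP => P; rewrite /with_units; set o := (3 * K)%N in p *; rewrite /=.
have := permP (perm_map (fun k => (1%N, k)) p) P.
by rewrite !map_cat !count_cat; do 7?move: (count P _) => ?; lia.
Qed.

(** The convention of [rect_type]: shorter side first. *)
Definition oriented (a : nat * nat) : nat * nat := (minn a.1 a.2, maxn a.1 a.2).

Lemma eq_from_count_parts (N : nat) (f g : multiplicities N) :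
  (forall v, (0 < v)%N -> count_mem v (parts f) = count_mem v (parts g)) -> f = g.
Proof.
move=> fg; apply/ffunP => i; apply: val_inj.
by rewrite /= -!count_mem_parts; exact: fg.
Qed.

(** Only the tiles 2 x 1, 3 x 1 and 3 x 2 are confused with tiles of smaller
    width. Once their numbers are known, the tiles of width 3 can be read off,
    then those of width 2, then those of width 1. *)
Lemma with_units_inj (N o : nat)
    (t t' : multiplicities N * multiplicities N * multiplicities N) :
  seq_mset (map oriented (with_units o t)) = seq_mset (map oriented (with_units o t')) ->
  count_mem 1%N (parts t.1.2) = count_mem 1%N (parts t'.1.2) ->
  count_mem 1%N (parts t.2) = count_mem 1%N (parts t'.2) ->
  count_mem 2%N (parts t.2) = count_mem 2%N (parts t'.2) ->
  t = t'.
Proof.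
case: t t' => -[f g] h [[f' g'] h'] /= /eq_seq_msetP/permP p g1 h1 h2.
have cnt (u v : nat) (w : nat) (l : seq nat) :
    count_mem (u, v) (map oriented [seq (w, k) | k <- l]) =
    count (fun k => oriented (w, k) == (u, v)) l.
  by rewrite -map_comp count_map.
have none (w u v : nat) (l : seq nat) : (w < u)%N ->
    count (fun k => oriented (w, k) == (u, v)) l = 0%N.
  move=> wu; apply/eqP; rewrite -leqn0 leqNgt -has_count -all_predC.
  apply/allP => k _ /=; apply/negP => /eqP[+ _]; lia.
have same (w v : nat) (l : seq nat) : (w <= v)%N ->
    count (fun k => oriented (w, k) == (w, v)) l = count_mem v l.
  move=> wv; apply: eq_count => k /=; rewrite /oriented /= xpair_eqE.
  by apply/andP/eqP => [[/eqP ? /eqP]|->]; [lia|split; apply/eqP; lia].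
move: p; rewrite /with_units /strips /= !map_cat => p.
have hh : h = h'.
  apply: eq_from_count_parts => -[//|[|[|v]]] _ //.
  have := p (pred1 (3%N, v.+3)); rewrite !count_cat !cnt.
  by rewrite !(none 1%N 3%N)// !(none 2%N 3%N)// !same.
subst h'.
have gg : g = g'.
  apply: eq_from_count_parts => -[//|[|v]] _ //.
  have := p (pred1 (2%N, v.+2)); rewrite !count_cat !cnt.
  by rewrite !(none 1%N 2%N)// !same//; lia.
subst g'.
suff -> : f = f' by [].
apply: eq_from_count_parts => v v0.
have := p (pred1 (1%N, v)); rewrite !count_cat !cnt !same//.
by lia.
Qed.

Definition partitions_upto (N m K : nat) : {set multiplicities N} :=
  [set f in partitions_of N m | ~~ [exists i : 'I_N, (K <= i)%N && (0 < f i)%N]]%SET.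

Lemma partitions_upto_parts (N m K : nat) (f : multiplicities N) :
  f \in partitions_upto N m K -> all (fun k => k <= K)%N (parts f).
Proof.
rewrite inE => /andP[_ /existsPn fK]; apply/allP => k.
case/flattenP=> s /mapP[i _ ->] /nseqP[-> fi].
by have := fK i; rewrite fi andbT -ltnNge.
Qed.

(** Each triple gives a tiling by [tileable_with_units]. By [with_units_inj],
    triples with the same image are separated by three numbers, each at most
    [N]. *)
Lemma card_product_le_num_partitions (R : realType) (n K a b c : nat)
    (N := (3 * n)%N) :
  (0 < b)%N -> (0 < c)%N -> (b + c < n)%N ->
  (a + 3 * K + 2 * b + 3 * c = 3 * n)%N ->
  (#|partitions_upto N a K| * #|partitions_of N b| * #|partitions_of N c|
    <= N.+1 ^ 3 * num_partitions R 3 n)%N.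
Proof.
move=> b0 c0 bcn abc; have [fin _] := num_partitions_le_card R n.
pose S := finset.setX (finset.setX (partitions_upto N a K) (partitions_of N b))
  (partitions_of N c).
have <- : #|S| = (#|partitions_upto N a K| * #|partitions_of N b| *
    #|partitions_of N c|)%N.
  by rewrite !cardsX.
pose key (t : multiplicities N * multiplicities N *
              multiplicities N) : 'I_N.+1 * 'I_N.+1 * 'I_N.+1 :=
  (inord (count_mem 1%N (parts t.1.2)), inord (count_mem 1%N (parts t.2)),
   inord (count_mem 2%N (parts t.2))).
have small (v : nat) (f : multiplicities N) :
    (count_mem v (parts f) < N.+1)%N.
  have [/andP[v0 vN]|vN] := boolP (0 < v <= N)%N; last first.
    by rewrite count_mem_parts_out.
  case: v v0 vN => // v _ vN; rewrite (count_mem_parts _ (Ordinal vN)).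
  exact: ltn_ord.
rewrite -sum1_card (partition_big key xpredT)//=.
have -> : (N.+1 ^ 3 * num_partitions R 3 n =
    \sum_(d : 'I_N.+1 * 'I_N.+1 * 'I_N.+1) num_partitions R 3 n)%N.
  by rewrite sum_nat_const !card_prod card_ord !expnS expn0 muln1 mulnA.
apply: leq_sum => d _; rewrite sum1_card.
pose X := [fset seq_mset (map oriented (with_units (3 * K) t)) |
  t in [pred t | (t \in S) && (key t == d)]]%fset.
have <- : #|` X| = #|[pred t | (t \in S) && (key t == d)]|.
  rewrite card_in_imfset /=.
    by rewrite -sum1_size big_filter big_enum_cond -sum1_card.
  move=> t t' /= /andP[_ /eqP <-] /andP[_ /eqP[]].
  move=> /(congr1 val)/= + /(congr1 val)/= + /(congr1 val)/=.
  by rewrite !inordK// => k1 k2 k3 /with_units_inj; apply.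
rewrite /num_partitions; apply: fsubset_leq_card.
have subX : [set` X] `<=` rect_partitions R 3 n.
  move=> M /= /imfsetP[[[f g] h] /= /andP[+ _] ->].
  rewrite /S !finset.in_setX /= => /andP[/andP[fS gS] hS].
  have wg : weight g = b by move: gS; rewrite /partitions_of inE => /eqP.
  have wh : weight h = c by move: hS; rewrite /partitions_of inE => /eqP.
  have wf : weight f = a.
    by move: fS; rewrite /partitions_upto /partitions_of !inE => /andP[/eqP].
  have [|s ps /tileable_partition] :=
    @tileable_with_units R N n K b c (f, g, h) (partitions_upto_parts fS) wg wh b0 c0 bcn.
    by rewrite /= wf.
  by congr rect_partitions; apply/eq_seq_msetP/perm_map.
by rewrite -(set_fsetK X) -fset_set_sub.
Qed.

(** * Asymptotics *)

Lemma natr_le_expR_ln (R : realType) (k n : nat) : (0 < n)%N ->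
  (n ^ k)%N%:R = expR (k%:R * ln n%:R) :> R.
Proof. by move=> n0; rewrite expRM_natl lnK ?natrX// posrE ltr0n. Qed.

Lemma expR1_le4 (R : realType) : expR 1 <= 4 :> R.
Proof.
have h : expR (- (1 / 2)) >= 1 / 2 :> R.
  by have := expR_ge1Dx (- (1 / 2) : R); lra.
have e0 := expR_gt0 (1 / 2 : R).
have h1 : expR (1 / 2) <= 2 :> R.
  have := ler_wpM2l (ltW e0) h; rewrite expRxMexpNx_1; lra.
have -> : 1 = 1 / 2 + 1 / 2 :> R by field.
by rewrite expRD; nra.
Qed.

Lemma ln_nat_ge1 (R : realType) (n : nat) : (4 <= n)%N -> 1 <= ln n%:R :> R.
Proof.
move=> n4; have n0 : 0 < n%:R :> R by rewrite ltr0n; lia.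
rewrite -ler_expR lnK ?posrE//; apply: le_trans (expR1_le4 R) _.
by rewrite ler_nat.
Qed.

(** The constant and the polynomial factor of [card_partitions_ge], absorbed
    in a multiple of [ln n]. *)
Lemma card_partitions_ge_expR (R : realType) : exists2 beta : R, 0 <= beta &
  forall n m : nat, (4 <= n)%N -> (0 < m <= 3 * n)%N ->
  expR (hardy_ramanujan R * Num.sqrt m%:R - beta * ln n%:R)
    <= #|partitions_of (3 * n) m|%:R.
Proof.
have [A [C [A0 PA]]] := card_partitions_ge R.
exists (`|ln A| + 2 * C%:R) => [|n m n4 mN]; first by rewrite addr_ge0.
apply: le_trans (PA _ _ mN).
have n0 : (0 < n)%N by lia.
have L1 := ln_nat_ge1 R n4; set L := ln n%:R in L1 *.
have /andP[m0 m3] := mN; have mR : 0 < m%:R :> R by rewrite ltr0n.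
have mC : m%:R ^+ C <= expR (2 * C%:R * L).
  rewrite -[2 * C%:R]natrM -natr_le_expR_ln// expnM natrX.
  apply: lerXn2r; rewrite ?nnegrE// ler_nat (leq_trans m3)// expnS expn1.
  by rewrite leq_mul2r; lia.
have hA : expR (- `|ln A|) <= A.
  by rewrite -[X in _ <= X](lnK (_ : A \is Num.pos)) ?posrE// ler_expR lerNnormlW.
rewrite -[X in _ <= X]mulrCA expRD ler_wpM2l ?expR_ge0//.
rewrite mulrDl opprD expRD; apply: ler_pM; rewrite ?expR_ge0//.
  apply: le_trans hA; rewrite ler_expR lerN2 ler_peMr//.
by rewrite expRN lef_pV2 ?posrE ?expR_gt0 ?exprn_gt0.
Qed.

(** Removing a part larger than [K] from a partition of [a] leaves a partition
    of a smaller number, whose number is bounded by [card_partitions_le]. *)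
Lemma card_partitions_upto_ge (R : realType) (N a K : nat) : (a <= N)%N ->
  #|partitions_of N a|%:R -
    N%:R * expR (hardy_ramanujan R * Num.sqrt a%:R - K%:R / Num.sqrt a%:R)
  <= #|partitions_upto N a K|%:R.
Proof.
move=> aN; set c := hardy_ramanujan R; set s := Num.sqrt a%:R.
pose large := [set f in partitions_of N a |
  [exists i : 'I_N, (K <= i)%N && (0 < f i)%N]]%SET.
have split : #|partitions_of N a|%:R <= #|partitions_upto N a K|%:R + #|large|%:R :> R.
  rewrite -natrD ler_nat.
  have -> : partitions_of N a = (partitions_upto N a K :|: large)%SET.
    apply/setP => f; rewrite /partitions_upto /large !inE.
    by case: (_ == a); case: [exists i, _].
  by rewrite cardsU leq_subr.
rewrite lerBlDr; apply: (le_trans split); rewrite lerD2l.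
apply: (@le_trans _ _ (\sum_(i < N | (K <= i)%N)
    (if (i < a)%N then #|partitions_of N (a - i.+1)| else 0%N))%N%:R).
  by rewrite ler_nat card_partitions_large_part.
rewrite natr_sum.
apply: (@le_trans _ _ (\sum_(i < N) expR (c * s - K%:R / s))); last first.
  by rewrite sumr_const card_ord -[X in X <= _]mulr_natl.
rewrite big_mkcond /=; apply: ler_sum => i _.
case: ifP => [Ki|_]; last exact: expR_ge0.
case: ifP => [ia|_]; last exact: expR_ge0.
have aR : 0 < a%:R :> R by rewrite ltr0n; lia.
have s0 : 0 < s by rewrite sqrtr_gt0.
have aiN : (a - i.+1 <= N)%N by lia.
apply: (le_trans (card_partitions_le R aiN)); rewrite ler_expR natrB//.
have ia' : i.+1%:R <= a%:R :> R by rewrite ler_nat.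
have c2 := hardy_ramanujan_ge2 R; have c0 := hardy_ramanujan_gt0 R.
apply: (le_trans (ler_wpM2l (ltW c0) (sqrt_sub_le aR ia'))).
rewrite -/c -/s mulrBr lerD2l lerN2.
have -> : c * (i.+1%:R / (2 * s)) = (c / 2) * i.+1%:R / s.
  by field; rewrite gt_eqF.
rewrite ler_pM2r ?invr_gt0//.
have Ki' : K%:R <= i.+1%:R :> R by rewrite ler_nat; lia.
have i0 : 0 <= i.+1%:R :> R by [].
by rewrite /c; nra.
Qed.

Lemma sqrt_sub_ge_lin (R : realType) (x y : R) : 0 < x -> 0 <= y <= x ->
  Num.sqrt x - y / Num.sqrt x <= Num.sqrt (x - y).
Proof.
move=> x0 yx; apply: le_trans (sqrt_sub_ge x0 yx); have /andP[y0 yx'] := yx.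
have s0 : 0 < Num.sqrt x by rewrite sqrtr_gt0.
set s := Num.sqrt x in s0 *; rewrite -addrA lerD2l -opprD lerN2.
have -> : y / s = y / (2 * s) + y / (2 * s) by field; rewrite gt_eqF.
rewrite lerD2l.
have -> : y ^+ 2 / (2 * s * x) = (y / x) * (y / (2 * s)).
  by field; rewrite !gt_eqF.
rewrite ler_piMl// ?ler_pdivrMr ?mul1r//.
by rewrite divr_ge0// mulr_ge0// ltW.
Qed.

Lemma ln_le_sqrt (R : realType) (delta : R) : 0 < delta ->
  exists n0 : nat, forall n : nat, (n0 <= n)%N ->
    ln n%:R <= delta * Num.sqrt n%:R.
Proof.
move=> d0; exists (Num.truncn (expR (8 / delta))).+1 => n nn0.
have e8 : expR (8 / delta) <= n%:R.
  have /andP[_ /ltW h] := truncn_itv (expR_ge0 (8 / delta)).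
  by apply: (le_trans h); rewrite ler_nat.
have n0 : 0 < n%:R :> R by apply: lt_le_trans e8; exact: expR_gt0.
set L := ln n%:R.
have nL : n%:R = expR L by rewrite lnK.
have L8 : 8 / delta <= L by rewrite -ler_expR -nL.
have L0 : 0 < L by apply: lt_le_trans L8; rewrite divr_gt0.
have L2 : 0 <= L / 2 by rewrite divr_ge0// ltW.
have sE : Num.sqrt n%:R = expR (L / 2).
  rewrite nL; have -> : expR L = expR (L / 2) ^+ 2 by rewrite -expRM_natr divfK.
  by rewrite sqrtr_sqr ger0_norm// expR_ge0.
have h := expR_ge1Dxn 1 L2.
have h2 : L ^+ 2 / 8 <= Num.sqrt n%:R.
  rewrite sE; apply: le_trans h; rewrite expr_div_n !factS fact0.
  have -> : L ^+ 2 / 2 ^+ 2 / (2 * (1 * 1))%N%:R = L ^+ 2 / 8 by field.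
  by rewrite lerDr.
apply: le_trans (ler_wpM2l (ltW d0) h2).
move: L8; rewrite ler_pdivrMr// => L8.
by rewrite expr2 -mulrA mulrCA; nra.
Qed.

(** The optimal lengths are proportional to 36, 9, 4; since
    [36 + 2 * 9 + 3 * 4 = 66 = 3 * 22], the unit [s] is about [n / 22]. The
    rounding errors and the [3 * K] unit squares are left to the strips of
    width 1. *)
Lemma split_lengths (n K s : nat) :
  (44 <= n)%N -> (22 * s <= n < 22 * s + 22)%N -> (K <= 6 * s)%N ->
  exists a : nat, [/\ (0 < a <= 3 * n)%N,
    (a + 3 * K + 2 * (9 * s) + 3 * (4 * s) = 3 * n)%N,
    (36 * s <= a + 3 * K)%N,
    (0 < 9 * s <= 3 * n)%N /\ (0 < 4 * s <= 3 * n)%N &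
    (9 * s + 4 * s < n)%N].
Proof.
move=> n44 /andP[s1 s2] Ks; exists (3 * n - 30 * s - 3 * K)%N.
by split; [lia|lia|lia|split; lia|lia].
Qed.

Lemma div22_bounds (n : nat) : (22 * (n %/ 22) <= n < 22 * (n %/ 22) + 22)%N.
Proof. by have := divn_eq n 22; have := ltn_pmod n (isT : 0 < 22)%N; lia. Qed.

Lemma natural_power_bounds (n : nat) : (4 <= n)%N ->
  (3 * n <= n ^ 2)%N /\ ((3 * n).+1 ^ 3 <= n ^ 6)%N.
Proof.
move=> n4; split.
- by rewrite expnS expn1 leq_mul2r; lia.
- by rewrite (expnM n 2 3) leq_exp2r// expnS expn1; nia.
Qed.

(** With [q = sqrt s], the three square roots are about [6 q], [3 q] and
    [2 q], and [11 * q] is about [11 * sqrt (n / 22) = sqrt (11 * n / 2)]. The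
    [3 * K] unit squares diminish the first root by about [K / (4 * q)], which
    is [O(L)]. *)
Lemma saddle_exponent_ge (R : realType) (kappa L : R) (n s K a : nat)
    (c := hardy_ramanujan R) :
  0 < kappa -> 1 <= L -> (0 < s)%N -> (n <= 22 * s + 22)%N ->
  K%:R <= kappa * (Num.sqrt n%:R * L) -> (K <= 6 * s)%N ->
  (36 * s <= a + 3 * K)%N ->
  pi * Num.sqrt (11%:R * n%:R / 3%:R) - 11 * c - 4 * kappa * c * L <=
  c * Num.sqrt a%:R + c * Num.sqrt (9 * s)%N%:R + c * Num.sqrt (4 * s)%N%:R.
Proof.
move=> kappa0 L1 s0 ns Kle K6s aKs.
have c0 : 0 < c by exact: hardy_ramanujan_gt0.
have sR0 : 1 <= s%:R :> R by rewrite ler1n.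
have nsR : n%:R <= 22 * s%:R + 22 :> R by rewrite -natrM -natrD ler_nat.
have KR : K%:R <= 6 * s%:R :> R by rewrite -natrM ler_nat.
have K0 : 0 <= K%:R :> R by [].
have age : 36 * s%:R - 3 * K%:R <= a%:R :> R.
  by rewrite lerBlDr -!natrM -natrD ler_nat.
have sq0 : 0 < Num.sqrt s%:R :> R by rewrite sqrtr_gt0; lra.
have sqS (k : nat) : Num.sqrt (k ^ 2 * s)%N%:R = k%:R * Num.sqrt s%:R :> R.
  by rewrite natrM natrX sqrtrM ?exprn_ge0// sqrtr_sqr ger0_norm.
have -> : Num.sqrt (9 * s)%N%:R = 3 * Num.sqrt s%:R :> R := sqS 3%N.
have -> : Num.sqrt (4 * s)%N%:R = 2 * Num.sqrt s%:R :> R := sqS 2%N.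
set q := Num.sqrt s%:R in sq0 sqS *.
have q2 : q ^+ 2 = s%:R by rewrite sqr_sqrtr.
have X11 : pi * Num.sqrt (11%:R * n%:R / 3%:R) <= 11 * c * (q + 1).
  have -> : 11 * c * (q + 1) = pi * (11 * Num.sqrt (2 / 3) * (q + 1)).
    by rewrite /c /hardy_ramanujan; move: (pi : R) => p; ring.
  rewrite ler_wpM2l ?pi_ge0//; apply: sqrt_le_of_sqr.
    by rewrite mulr_ge0 ?mulr_ge0 ?sqrtr_ge0// addr_ge0// ltW.
  rewrite !exprMn sqr_sqrtr ?divr_ge0//.
  have -> : (q + 1) ^+ 2 = s%:R + 1 + 2 * q by rewrite -q2; ring.
  lra.
have sqa : 6 * q - 4 * kappa * L <= Num.sqrt a%:R.
  have r7 : Num.sqrt n%:R <= 7 * q.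
    apply: sqrt_le_of_sqr; first by rewrite mulr_ge0// ltW.
    by rewrite exprMn q2 -natrX; lra.
  have y01 : 0 <= 3 * (K%:R : R) <= 36 * s%:R by apply/andP; split; lra.
  have x0 : 0 < 36 * s%:R :> R by lra.
  apply: (le_trans _ (ler_wsqrtr age)).
  apply: (le_trans _ (sqrt_sub_ge_lin x0 y01)).
  have -> : Num.sqrt (36 * s%:R) = 6 * q by rewrite -natrM; exact: (sqS 6%N).
  rewrite lerD2l lerN2 ler_pdivrMr ?mulr_gt0//.
  have h : kappa * (Num.sqrt n%:R * L) <= kappa * (7 * q * L).
    by rewrite ler_wpM2l ?(ltW kappa0)// ler_wpM2r//; lra.
  have g0 : 0 <= kappa * (q * L) by rewrite !mulr_ge0//; lra.
  move: Kle h g0; clear; lra.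
have := ler_wpM2l (ltW c0) sqa; move: X11; clear; lra.
Qed.

(** Apply [card_product_le_num_partitions] with the lengths of [split_lengths]
    and [K] about [2 * (beta + 3) * sqrt n * ln n], where the multiple is
    chosen so that partitions with a part larger than [K] are at most half of
    the lower bound for the number of partitions of [a]. *)
Lemma num_partitions_ge (R : realType) : exists (B : R) (n0 : nat),
  forall n : nat, (n0 <= n)%N ->
  expR (pi * Num.sqrt (11%:R * n%:R / 3%:R) - B * ln n%:R)
    <= (num_partitions R 3 n)%:R.
Proof.
have [beta beta0 Pge] := card_partitions_ge_expR R.
set c := hardy_ramanujan R.
have c0 : 0 < c by exact: hardy_ramanujan_gt0.
pose kappa := 2 * beta + 7; have kappa0 : 0 < kappa by rewrite /kappa; lra.
have delta0 : 0 < 3 / 22 / kappa by rewrite !divr_gt0.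
have [n1 Lsmall] := ln_le_sqrt delta0.
exists (11 * c + 4 * kappa * c + 3 * beta + 7), (maxn n1 44) => n.
rewrite geq_max => /andP[nn1 n44].
have {}Lsmall := Lsmall n nn1.
have n4 : (4 <= n)%N by lia.
have npos : (0 < n)%N by lia.
have [N2n N3n] := natural_power_bounds n4.
have sn := div22_bounds n; have /andP[s1 s2] := sn.
have L1 := ln_nat_ge1 R n4.
have nR : 44 <= n%:R :> R by rewrite ler_nat.
have expL k : (n ^ k)%N%:R = expR (k%:R * ln n%:R) :> R by exact: natr_le_expR_ln.
set L := ln n%:R in Lsmall L1 expL *.
set r := Num.sqrt n%:R in Lsmall *.
have r2 : r ^+ 2 = n%:R by rewrite sqr_sqrtr.
have r0 : 0 <= r by exact: sqrtr_ge0.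
have r1 : 1 <= r by apply: le_sqrt_of_sqr => //; rewrite expr1n; lra.
have rL1 : 1 <= r * L by nra.
have y0 : 0 <= 2 * (beta + 3) * (r * L) by rewrite !mulr_ge0//; lra.
pose K := (Num.truncn (2 * (beta + 3) * (r * L))).+1.
have [Kge Kle] : 2 * (beta + 3) * (r * L) <= K%:R /\ K%:R <= kappa * (r * L).
  have /andP[k1 k2] := truncn_itv y0; split; first exact: ltW.
  by rewrite /K -natr1 /kappa; nra.
clearbody K.
set s := (n %/ 22)%N in s1 s2 sn; clearbody s.
have sR1 : 22 * s%:R <= n%:R :> R by rewrite -natrM ler_nat.
have sR2 : n%:R <= 22 * s%:R + 22 :> R by rewrite -natrM -natrD ler_nat ltnW.
have sR : n%:R <= 44 * s%:R :> R by lra.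
have sR0 : 0 < s%:R :> R by lra.
have K6s : (K <= 6 * s)%N.
  rewrite -(ler_nat R) natrM; apply: (le_trans Kle).
  have h : kappa * (r * L) <= kappa * (r * (3 / 22 / kappa * r)).
    by rewrite ler_wpM2l ?(ltW kappa0)// ler_wpM2l.
  have e : kappa * (r * (3 / 22 / kappa * r)) = 3 / 22 * n%:R.
    by rewrite -r2; field; rewrite gt_eqF.
  by rewrite e in h; lra.
have spos : (0 < s)%N by rewrite -(ltr_nat R).
have [a [aN' aE aKs [bN cN] bcn]] := split_lengths n44 sn K6s.
have /andP[a0 aN] := aN'.
have aR0 : 0 < a%:R :> R by rewrite ltr0n.
have sa0 : 0 < Num.sqrt a%:R :> R by rewrite sqrtr_gt0.
have upto : expR (c * Num.sqrt a%:R - (beta + 1) * L)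
    <= #|partitions_upto (3 * n) a K|%:R.
  apply: le_trans (card_partitions_upto_ge R K aN); rewrite -/c.
  have := Pge n a n4 aN'; rewrite -/L -/c; set E := expR (_ - beta * L).
  have E0 : 0 < E by exact: expR_gt0.
  (* [big]: partitions with a part larger than [K] are at most a proportion
     [expR (- L) = 1 / n] of the lower bound [E]. *)
  have half : expR (- L) <= 1 / 2.
    rewrite expRN lnK ?posrE; last by lra.
    by rewrite -[X in X <= _]mul1r ler_pdivrMr; lra.
  have big : (3 * n)%N%:R * expR (c * Num.sqrt a%:R - K%:R / Num.sqrt a%:R)
      <= E * expR (- L).
    have N2 : (3 * n)%N%:R <= expR (2 * L).
      by rewrite -expL ler_nat.
    have sa2r : Num.sqrt a%:R <= 2 * r.
      apply: sqrt_le_of_sqr; first by rewrite mulr_ge0.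
      by rewrite exprMn r2 -natrX -natrM ler_nat (leq_trans aN)// leq_mul2r orbT.
    have Ka : (beta + 3) * L <= K%:R / Num.sqrt a%:R.
      rewrite ler_pdivlMr//; apply: le_trans Kge.
      have bL : 0 <= (beta + 3) * L by rewrite mulr_ge0//; lra.
      have := ler_wpM2l bL sa2r; lra.
    apply: (le_trans (ler_wpM2r (expR_ge0 _) N2)).
    by rewrite /E -!expRD ler_expR; lra.
  have -> : c * Num.sqrt a%:R - (beta + 1) * L =
    (c * Num.sqrt a%:R - beta * L) + (- L) by ring.
  rewrite expRD -/E => PE.
  have := ler_wpM2l (ltW E0) half; move: PE big.
  by set p := #|_|%:R; set q := _ * expR (_ - _); set w := E * expR (- L); lra.
have Pb := Pge n _ n4 bN; have Pc := Pge n _ n4 cN; rewrite -/c -/L in Pb Pc.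
have [b0' _] := andP bN; have [c0' _] := andP cN.
have := card_product_le_num_partitions R b0' c0' bcn aE.
rewrite -(ler_nat R) [X in X <= _]natrM [X in X * _ <= _]natrM [X in _ <= X]natrM.
move=> prod.
have N6 : ((3 * n).+1 ^ 3)%N%:R <= expR (6 * L).
  by rewrite -expL ler_nat.
set X := pi * _.
have key : X - (11 * c + 4 * kappa * c + 3 * beta + 7) * L + 6 * L <=
  (c * Num.sqrt a%:R - (beta + 1) * L) +
  (c * Num.sqrt (9 * s)%N%:R - beta * L) + (c * Num.sqrt (4 * s)%N%:R - beta * L).
  have := @saddle_exponent_ge R kappa L n s K a kappa0 L1 spos (ltnW s2) Kle K6s aKs.
  rewrite -/c -/X; have : c <= c * L by rewrite ler_peMr// ltW.
  have : beta <= beta * L by rewrite ler_peMr.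
  set u := c * Num.sqrt _; set v := c * Num.sqrt _; set w := c * Num.sqrt _.
  move: X u v w => X u v w; clear -L1; lra.
have num0 : 0 <= (num_partitions R 3 n)%:R :> R by [].
have := le_trans prod (ler_wpM2r num0 N6).
have : expR (X - (11 * c + 4 * kappa * c + 3 * beta + 7) * L + 6 * L) <=
   #|partitions_upto (3 * n) a K|%:R * #|partitions_of (3 * n) (9 * s)|%:R *
   #|partitions_of (3 * n) (4 * s)|%:R.
  apply: (@le_trans _ _ (expR (c * Num.sqrt a%:R - (beta + 1) * L) *
    expR (c * Num.sqrt (9 * s)%N%:R - beta * L) *
    expR (c * Num.sqrt (4 * s)%N%:R - beta * L))).
    by rewrite -!expRD ler_expR.
  apply: ler_pM; rewrite ?mulr_ge0 ?expR_ge0//.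
  by apply: ler_pM; rewrite ?expR_ge0.
move=> /le_trans h /h; rewrite expRD [X in _ <= X]mulrC ler_pM2r//.
exact: expR_gt0.
Qed.

Theorem theorem1p9 (R : realType) :
  exists g : nat -> R,
    g =O_\oo (fun n : nat => ln (n%:R : R)) /\
    \forall n \near \oo,
      (num_partitions R 3 n)%:R =
      expR (pi * Num.sqrt (11%:R * n%:R / 3%:R) + g n).
Proof.
have [B [n0 lower]] := num_partitions_ge R.
pose X n : R := pi * Num.sqrt (11%:R * n%:R / 3%:R).
pose g n : R := ln (num_partitions R 3 n)%:R - X n.
have num_gt0 n : (n0 <= n)%N -> 0 < (num_partitions R 3 n)%:R :> R.
  by move=> nn0; apply: lt_le_trans (lower n nn0); exact: expR_gt0.
exists g; split; last first.
  exists n0 => // n /= nn0.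
  by rewrite /g addrC subrK lnK// posrE num_gt0.
apply/eqO_exP; exists (`|B| + 6) => [|]; first by rewrite ltr_wpDl.
exists (maxn n0 4) => // n /=; rewrite geq_max => /andP[nn0 n4].
have L1 := ln_nat_ge1 R n4; set L := ln n%:R in L1 *.
have L0 : 0 <= L by exact: le_trans L1.
rewrite [X in _ * X]ger0_norm//.
have lo : X n - B * L <= ln (num_partitions R 3 n)%:R.
  by rewrite -ler_expR lnK ?posrE ?num_gt0//; exact: lower.
have up : ln (num_partitions R 3 n)%:R <= X n + 6 * L.
  rewrite -ler_expR lnK ?posrE ?num_gt0//; apply: (le_trans (num_partitions_le R n)).
  rewrite addrC expRD ler_wpM2r ?expR_ge0// -natrX.
  have [_ crude] := natural_power_bounds n4.
  by rewrite -natr_le_expR_ln ?ler_nat//; lia.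
have BL : B * L <= `|B| * L by rewrite ler_wpM2r// ler_norm.
have BL0 : 0 <= `|B| * L by rewrite mulr_ge0.
rewrite /g ler_norml; move: (X n) (ln _%:R) lo up => x y lo up.
by apply/andP; split; lra.
Qed.
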